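(* Let $X$ be a conservative $m$-symmetric Borel right process with continuous sample paths on $E$, let $F\subset E$ be closed, let $U$ and $V$ be the Feller measure and supplementary Feller measure for $F$, and let $\kappa$ be the random measure of endpoints of excursions away from $F$ defined in the context. Let $f,g\in\mathcal B_+(F)$ (nonnegative measurable functions on $F$). Then $$E^m\kappa(f\otimes g,(0,t))=t\,U(f\otimes g),\qquad E^m\kappa(f\otimes I_\Delta,(0,t))=t\,V(f),\qquad t>0 .$$
   Context: $E$ is a Lusin topological space, $m$ a $\sigma$-finite positive Borel measure on $E$, and $X=(X_t,P^x)$ a conservative Borel right process on $E$ with paths continuous on $[0,\infty)$, $m$-symmetric: its transition function satisfies $\int p_tf\,g\,dm=\int f\,p_tg\,dm$ for nonnegative Borel $f,g$. $F\subset E$ is closed, $G=E\setminus F$, $m_G=1_G\cdot m$, $T=\inf\{t>0:X_t\in F\}$ ($\inf\varnothing=\infty$). $E^m=\int E^x(\cdot)\,m(dx)$. Feller measures: $p_t^0(x,A)=P^x(X_t\in A,t<T)$ for $x\in G$, $A\subset G$ is the transition function of the process $X_G$ killed on leaving $G$. For $X_G$-almost-excessive $u,v$ (nonnegative, with $p_t^0u\uparrow u$ $m_G$-a.e. as $t\downarrow0$, and likewise for $v$) finite $m_G$-a.e., put $L_G(u,v)=\lim_{t\downarrow0}\frac1t\int_G(u-p_t^0u)v\,dm$ (an increasing limit in $[0,\infty]$). With $Hf(x)=E^x(f(X_T);T<\infty)$ and $q(x)=P^x(T=\infty)$ on $G$, set $U(f\otimes g)=L_G(Hf,Hg)$, $V(f)=L_G(Hf,q)$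 for bounded nonnegative Borel $f,g$ on $F$ (extended by monotone limits to nonnegative measurable ones). Excursions: for $t\ge0$, $R(t)=\inf\{s>t:X_s\in F\}$ ($\inf\varnothing=\infty$), and $R(s-)$ is the left limit of $R$ at $s$. Add an extra point $\Delta$ to $E$, put $X_\infty=\Delta$ and $F_\Delta=F\cup\{\Delta\}$. For nonnegative measurable $\Psi$ on $F_\Delta\times F_\Delta$, $$\kappa(\Psi,dt)=\sum_{0<s:\,R(s-)<R(s)}\Psi(X_{R(s-)},X_{R(s)})\,\varepsilon_s(dt),$$ with $\varepsilon_s$ the point mass at $s$. Functions on $F$ are extended to $F_\Delta$ by $f(\Delta)=0$; $(f\otimes g)(x,y)=f(x)g(y)$ and $(f\otimes I_\Delta)(x,y)=f(x)I_{\{\Delta\}}(y)$. *)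

(* Defs.v *)
From HB Require Import structures.
From mathcomp Require Import all_boot all_order all_algebra.
From mathcomp Require Import all_classical all_reals all_analysis.
From mathcomp Require Import measurable_realfun lebesgue_stieltjes_measure.

Set Implicit Arguments.
Unset Strict Implicit.
Unset Printing Implicit Defensive.

Import Order.TTheory GRing.Theory Num.Theory.
Import numFieldNormedType.Exports.

Local Open Scope classical_set_scope.
Local Open Scope ring_scope.
Local Open Scope ereal_scope.

Notation borel E := (g_sigma_algebraType (@open E)).

(* Lusin topological space: homeomorphic to a Borel subset of a compact metric
   space; the last conjunct says that the continuous injection [h] is open onto
   its image. *)
Definition lusin_space (R : realType) (E : topologicalType) : Prop :=
  exists (K : metricType R) (h : E -> K),
    [/\ compact [set: K], <<s @open K >> (range h), injective h, continuous h &
        forall O : set E, open O -> exists2 O' : set K, open O' & O = h @^-1` O'].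

(* Membership in the completion of the Borel sigma-algebra with respect to every
   probability measure. *)
Definition universally_measurable_set (R : realType) (E : ptopologicalType)
    (A : set E) : Prop :=
  forall mu : probability (borel E) R,
    exists A1 A2 : set (borel E),
      [/\ measurable A1, measurable A2, A1 `<=` A, A `<=` A2 &
          mu (A2 `\` A1) = 0].

Definition universally_measurable_fun (R : realType) (E : ptopologicalType)
    (u : E -> \bar R) : Prop :=
  forall B : set (\bar R), measurable B ->
    universally_measurable_set R (u @^-1` B).

Section process.
Context (R : realType) (E : ptopologicalType) (d : measure_display)
  (Omega : measurableType d).
(* Only the times [t >= 0] of [X] and [theta] are meaningful. *)
Variables (X : R -> Omega -> E) (theta : R -> Omega -> Omega)
  (P : R.-pker (borel E) ~> Omega).

(* [p_t u (x) = E^x (u (X_t))] *)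
Definition semigroup (t : R) (u : E -> \bar R) (x : E) : \bar R :=
  \int[P x]_w u (X t w).

(* The sigma-algebra generated by the [X_s], [0 <= s <= t]. *)
Definition natural_filtration (t : R) : set_system Omega :=
  <<s [set A | exists s (B : set (borel E)),
        [/\ (0 <= s <= t)%R, measurable B & A = X s @^-1` B]] >>.

Definition excessive (a : R) (u : E -> \bar R) : Prop :=
  [/\ universally_measurable_fun u,
      forall x, 0 <= u x,
      forall t x, (0 <= t)%R -> (expR (- a * t))%:E * semigroup t u x <= u x &
      forall x, (expR (- a * t))%:E * semigroup t u x @[t --> 0%R^'+] --> u x].

(* [bad] is null under every initial law [mu], i.e. for
   [P^mu = \int P^x mu(dx)]. *)
Definition almost_surely_null (bad : set Omega) : Prop :=
  forall mu : probability (borel E) R,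
    exists N : set Omega,
      [/\ measurable N, bad `<=` N & \int[mu]_x P x N = 0].

(* Conservativity is built in: [X_t] takes its values in [E] at all times and
   each [P x] is a probability measure.  [brp_excessive] is Meyer's hypothesis
   (HD2). *)
Record conservative_borel_right_process : Prop := {
  brp_measurable : forall t, (0 <= t)%R ->
    measurable_fun [set: Omega] (X t : Omega -> borel E);
  brp_right_continuous : forall w t, (0 <= t)%R ->
    X s w @[s --> t^'+] --> X t w;
  brp_shift : forall s t w, (0 <= s)%R -> (0 <= t)%R ->
    X s (theta t w) = X (s + t)%R w;
  brp_initial : forall x, P x (X 0%R @^-1` [set x]) = 1;
  brp_markov : forall x s t (A : set Omega) (B : set (borel E)),
    (0 <= s)%R -> (0 <= t)%R ->
    natural_filtration t A -> measurable B ->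
    P x (A `&` X (s + t)%R @^-1` B) =
      \int[P x]_(w in A) P (X t w) (X s @^-1` B);
  brp_excessive : forall a u, (0 < a)%R -> excessive a u ->
    almost_surely_null
      [set w | ~ forall t, (0 <= t)%R ->
                   u (X s w) @[s --> t^'+] --> u (X t w)]
}.

Definition continuous_paths : Prop :=
  forall w, {within [set t | (0 <= t)%R], continuous (X ^~ w)}.

Variable m : {measure set (borel E) -> \bar R}.

Definition symmetric_process : Prop :=
  forall t (u v : borel E -> \bar R), (0 <= t)%R ->
    measurable_fun [set: borel E] u -> measurable_fun [set: borel E] v ->
    (forall x, 0 <= u x) -> (forall x, 0 <= v x) ->
    \int[m]_x (semigroup t u x * v x) = \int[m]_x (u x * semigroup t v x).

(* [E^m] *)
Definition expectation_m (Y : Omega -> \bar R) : \bar R :=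
  \int[m]_x \int[P x]_w Y w.

Variable F : set E.

(* [R(t) = inf {s > t : X_s \in F}]; the infimum of the empty set is [+oo]. *)
Definition next_hit (w : Omega) (t : R) : \bar R :=
  ereal_inf [set s%:E | s in [set s | (t < s)%R /\ F (X s w)]].

(* [R(s-)] *)
Definition next_hit_left (w : Omega) (s : R) : \bar R :=
  lim (next_hit w u @[u --> s^'-]).

Definition hitting_time (w : Omega) : \bar R := next_hit w 0%R.

(* [p^0_t u (x) = E^x (u (X_t); t < T)] *)
Definition killed_semigroup (t : R) (u : E -> \bar R) (x : E) : \bar R :=
  \int[P x]_(w in [set w | t%:E < hitting_time w]) u (X t w).

(* Meaningful for [u], [v] almost-excessive for the killed process and finite
   a.e. on the complement of [F]; the limit is then increasing. *)
Definition energy (u v : E -> \bar R) : \bar R :=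
  lim ((t^-1)%:E * \int[m]_(x in ~` F) ((u x - killed_semigroup t u x) * v x)
       @[t --> 0%R^'+]).

(* [H f (x) = E^x (f (X_T); T < oo)] *)
Definition hitting_operator (f : E -> \bar R) (x : E) : \bar R :=
  \int[P x]_(w in [set w | hitting_time w < +oo])
    f (X (fine (hitting_time w)) w).

Definition never_hit (x : E) : \bar R :=
  P x [set w | hitting_time w = +oo].

(* [f /\ n]: the energy form is only applied to bounded functions, and extended
   by monotone limits. *)
Definition truncate (n : nat) (f : E -> \bar R) (x : E) : \bar R :=
  Order.min (f x) n%:R%:E.

(* [U (f (x) g)] *)
Definition feller_measure (f g : E -> \bar R) : \bar R :=
  limn (fun n => energy (hitting_operator (truncate n f))
                        (hitting_operator (truncate n g))).

(* [V (f)] *)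
Definition supplementary_feller_measure (f : E -> \bar R) : \bar R :=
  limn (fun n => energy (hitting_operator (truncate n f)) never_hit).

(* The extra point [Delta] is [None : option E]; the value at [-oo] is junk. *)
Definition extended_process (t : \bar R) (w : Omega) : option E :=
  if t is s%:E then Some (X s w) else None.

Definition excursion_measure (Psi : option E -> option E -> \bar R)
    (w : Omega) (A : set R) : \bar R :=
  \esum_(s in [set s | (0 < s)%R /\ next_hit_left w s < next_hit w s])
    (Psi (extended_process (next_hit_left w s) w)
         (extended_process (next_hit w s) w) * \d_s A).

End process.

Definition extend_by_zero (R : realType) (E : Type) (f : E -> \bar R)
    (z : option E) : \bar R :=
  if z is Some x then f x else 0.

Definition tensor (R : realType) (E : Type) (f g : E -> \bar R)
    (y z : option E) : \bar R :=
  extend_by_zero f y * extend_by_zero g z.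

Definition tensor_Delta (R : realType) (E : Type) (f : E -> \bar R)
    (y z : option E) : \bar R :=
  extend_by_zero f y * (if z is None then 1 else 0).

(* Main.v *)
Require Import Defs.
From HB Require Import structures.
From mathcomp Require Import all_boot all_order all_algebra finmap.
From mathcomp Require Import all_classical all_reals all_analysis.
From mathcomp Require Import measurable_realfun lebesgue_stieltjes_measure.
From mathcomp Require Import lra.

(** An excursion away from [F] is recorded at its left endpoint: for [s > 0],
    [R(s-) < R(s)] holds exactly when [X_s] is in [F] and [R(s) > s], and then
    [R(s-) = s].  So [kappa(f (x) g, (0, t))] is the sum, over these left
    endpoints [s < t], of [f(X_s)] times the value of [g] at the first hit of [F]
    after [s].

    Fix a step [delta].  At most one excursion starts in the cell
    [a <= s < a + delta] and is still running at time [b = a + delta].  Its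
    starting point is the first point of [F] met by the path reversed from [b],
    and its end is the first point of [F] met after [b].  By symmetry and
    conservativity [P^m] is stationary and reversible, so, given [X_b = x], the
    reversed past and the future are independent copies of the process started
    at [x], and [X_b] has law [m] ([reversed_past_and_future]).  Writing [G] for
    the complement of [F], the expected contribution of this excursion is

      [int_G E^x(f(X_T); T <= delta) Hg(x) m(dx) = int_G (Hf - p^0_delta Hf) Hg dm],

    where the equality is the Markov property at time [delta]
    ([energy_increment]).  It is the same for every cell
    ([integral_straddling_value]).

    Now add up the cells [k delta <= s < (k + 1) delta] inside [(0, t)].  No
    excursion is counted twice, and each one is counted as soon as [delta] is
    small, so these sums are bounded by [kappa((0, t))] and converge to it
    ([straddling_sum_le], [excursion_sum_le_liminf]); Fatou's lemma carries the
    convergence over to expectations.  There are about [t / delta] cells, whence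
    [E^m kappa((0, t)) = t L_G(Hf, Hg)], together with the existence of the limit
    that defines [L_G] ([cvg_energy_increment]).

    The function [g] enters only through a functional of the path that does not
    change when the path is shifted by a time shorter than [T].  The indicator of
    [T = oo], whose expectation is [q], has the same property, and both formulas
    follow from the one argument.  Bounded [f] are needed for [Hf - p^0_delta Hf]
    to make sense; monotone convergence gives the general case
    ([excursion_rate]).

    All this takes place on the space of continuous paths.  There, because [F] is
    closed in a metrizable space, hitting times and hitting places are Borel, and
    the identities between path laws are obtained from their values on
    finite-dimensional cylinders by a pi-lambda argument ([pf_eq_on_pi_system]). *)

Set Implicit Arguments.
Unset Strict Implicit.
Unset Printing Implicit Defensive.

Import Order.TTheory GRing.Theory Num.Theory.
Import numFieldNormedType.Exports.

Local Open Scope classical_set_scope.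
Local Open Scope ring_scope.
Local Open Scope ereal_scope.

(** * The space of continuous paths *)

Section path_space.
Context (R : realType) (E : ptopologicalType).

(** Paths are defined on all of [R] so that continuity is plain continuity; only the
    times [s >= 0] enter the sigma-algebra. *)
Record cpath := Path { path_val :> R -> E ; path_cts : continuous path_val }.

Lemma path_eq (c c' : cpath) : (c : R -> E) = c' -> c = c'.
Proof.
case: c c' => [c hc] [c' hc'] /= cc'; subst c'.
by congr Path; exact: Prop_irrelevance.
Qed.

HB.instance Definition _ := gen_eqMixin cpath.
HB.instance Definition _ := gen_choiceMixin cpath.

Lemma constant_path_continuous (x : E) : continuous (fun _ : R => x).
Proof. by move=> s; exact: cvg_cst. Qed.

HB.instance Definition _ :=
  isPointed.Build cpath (Path (@constant_path_continuous point)).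

Definition cylinders : set (set cpath) :=
  [set A | exists s (B : set (borel E)),
     [/\ (0 <= s)%R, measurable B & A = (fun c : cpath => c s) @^-1` B]].

End path_space.

Notation paths R E := (g_sigma_algebraType (@cylinders R E)).

Definition coord (R : realType) (E : ptopologicalType) (s : R) (c : paths R E) : E :=
  (c : cpath R E) s.

Lemma coord_continuous (R : realType) (E : ptopologicalType) (c : paths R E) :
  continuous (fun s => coord s c).
Proof. by case: c => c hc; exact: hc. Qed.

Section path_space_measurability.
Context (R : realType) (E : ptopologicalType).
Implicit Types (d : measure_display).

Lemma measurable_coord (s : R) : (0 <= s)%R ->
  measurable_fun [set: paths R E] (coord s : paths R E -> borel E).
Proof.
by move=> s0 _ B mB; rewrite setTI; apply: sub_gen_smallest; exists s, B.
Qed.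

(** Stated for an arbitrary sigma-algebra [S], because it is also applied to the
    members of the natural filtration. *)
Lemma preimage_paths (T : Type) (S : set (set T)) (Z : T -> paths R E) :
  sigma_algebra setT S ->
  (forall s (B : set (borel E)), (0 <= s)%R -> measurable B ->
     S ((fun w => coord s (Z w)) @^-1` B)) ->
  forall A : set (paths R E), measurable A -> S (Z @^-1` A).
Proof.
move=> sS h A mA.
have sI := sigma_algebra_image Z sS.
suff : <<s @cylinders R E >> `<=` image_set_system setT Z S.
  by move=> /(_ _ mA); rewrite /image_set_system /= setTI.
apply: smallest_sub => // _ [s [B [s0 mB ->]]].
by rewrite /image_set_system /= setTI; exact: h.
Qed.

Lemma measurable_fun_paths d (T : measurableType d) (Z : T -> paths R E) :
  (forall s, (0 <= s)%R ->
     measurable_fun [set: T] (fun w => coord s (Z w) : borel E)) ->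
  measurable_fun [set: T] Z.
Proof.
move=> h _ A mA; rewrite setTI.
apply: (@preimage_paths T (@measurable d T)) => //.
  exact: sigma_algebra_measurable.
by move=> s B s0 mB; rewrite -[X in measurable X]setTI; exact: h.
Qed.

End path_space_measurability.

(** * The next hit of a set *)

Section hitting_times.
Context (R : realType) (E : ptopologicalType) (F : set E).
Implicit Types (c : paths R E).

Local Notation nh c t := (next_hit (@coord R E) F c t).

Lemma next_hit_ge c t : t%:E <= nh c t.
Proof.
by apply: le_ereal_inf_tmp => _ /= [s [ts _] <-]; rewrite lee_fin ltW.
Qed.

Lemma next_hit_le c t s : (t < s)%R -> F (coord s c) -> nh c t <= s%:E.
Proof. by move=> ts Fs; apply: ereal_inf_lbound; exists s. Qed.

Lemma lt_next_hit_notin c t s : (t < s)%R -> s%:E < nh c t ->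
  ~ F (coord s c).
Proof. by move=> ts sR Fs; have := next_hit_le ts Fs; rewrite leNgt sR. Qed.

Lemma next_hit_lt_ex c t r : nh c t < r%:E ->
  exists s, [/\ (t < s)%R, (s < r)%R & F (coord s c)].
Proof.
move=> /ereal_inf_lt[_ /= [s [ts Fs] <-]]; rewrite lte_fin => sr.
by exists s.
Qed.

Lemma le_next_hit c t (r : \bar R) :
  (forall s, (t < s)%R -> s%:E < r -> ~ F (coord s c)) -> r <= nh c t.
Proof.
move=> h; apply: le_ereal_inf_tmp => _ /= [s [ts Fs] <-].
by rewrite leNgt; apply/negP => sr; exact: (h s).
Qed.

Hypothesis hF : closed F.

(** A finite infimum is a hit or a limit of hits, hence in [F]: otherwise the path
    would avoid [F] on a whole neighbourhood of it. *)
Lemma next_hit_fin c t : nh c t < +oo -> exists r : R,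
  [/\ nh c t = r%:E, (t <= r)%R & F (coord r c)].
Proof.
move=> foo.
have := next_hit_ge c t.
case Er : (nh c t) foo => [r| |] // _; rewrite lee_fin => tr; exists r; split => //.
apply: contrapT => nF.
have oF : open (~` F) by exact: closed_openC.
have : nbhs r ((fun s => coord s c) @^-1` (~` F)).
  by apply: coord_continuous; exact: open_nbhs_nbhs.
move=> [e /= e0 he].
have : nh c t < (r + e)%:E by rewrite Er lte_fin ltrDl.
move=> /next_hit_lt_ex[s [ts sre Fs]].
have rs : (r <= s)%R by rewrite -lee_fin -Er next_hit_le.
apply: (he s) => //=.
by rewrite ler0_norm ?subr_le0// opprB ltrBlDl.
Qed.

End hitting_times.

(** * Shifting, stopping and reversing paths *)

Section path_operations.
Context (R : realType) (E : ptopologicalType).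
Implicit Types (c : paths R E).

Definition retime (tau : R -> R) (htau : continuous tau) c : paths R E :=
  Path (fun s => continuous_comp (htau s) (@coord_continuous R E c (tau s))).

Lemma shift_time_continuous (a : R) : continuous (fun s : R => a + s)%R.
Proof. by move=> s; apply: cvgD; [exact: cvg_cst|exact: cvg_id]. Qed.

Lemma stop_time_continuous (a : R) : continuous (fun s : R => Order.min s a).
Proof.
move=> s; apply: (@continuous_min R R id (cst a)); [exact: cvg_id|exact: cvg_cst].
Qed.

Lemma reverse_time_continuous (a : R) :
  continuous (fun s : R => Order.max 0%R (a - s)%R).
Proof.
move=> s; apply: (@continuous_max R R (cst 0%R) (fun s => a - s)%R).
  exact: cvg_cst.
by apply: cvgB; [exact: cvg_cst|exact: cvg_id].
Qed.

Definition shift_path a := retime (@shift_time_continuous a).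
Definition stop_path a := retime (@stop_time_continuous a).
Definition reverse_path a := retime (@reverse_time_continuous a).

Lemma coord_shift a s c : coord s (shift_path a c) = coord (a + s) c.
Proof. by []. Qed.

Lemma coord_stop a s c : coord s (stop_path a c) = coord (Order.min s a) c.
Proof. by []. Qed.

Lemma coord_reverse a s c :
  coord s (reverse_path a c) = coord (Order.max 0%R (a - s)%R) c.
Proof. by []. Qed.

Lemma shift_shift a b c : shift_path b (shift_path a c) = shift_path (a + b) c.
Proof.
by apply: path_eq; apply/funext => s; rewrite /= /coord /= addrA.
Qed.

End path_operations.

(** * The excursion straddling a given time *)

Section hitting_functionals.
Context (R : realType) (E : ptopologicalType) (F : set E).
Implicit Types (c : paths R E).
Local Notation nh c t := (next_hit (@coord R E) F c t).
Local Notation T c := (hitting_time (@coord R E) F c).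

Lemma next_hit_const c t r : (t <= r)%R -> r%:E < nh c t -> nh c r = nh c t.
Proof.
move=> tr rn; apply/eqP; rewrite eq_le; apply/andP; split; apply: le_next_hit.
  move=> s ts sn; have [sr|rs] := leP s r.
    by apply: (@lt_next_hit_notin _ _ F c t) => //; apply: le_lt_trans rn.
  exact: (@lt_next_hit_notin _ _ F c r).
by move=> s rs sn; apply: (@lt_next_hit_notin _ _ F c t) => //; exact: le_lt_trans rs.
Qed.

Lemma next_hit_shift a c t : nh (shift_path a c) t = nh c (a + t) - a%:E.
Proof.
apply/eqP; rewrite eq_le; apply/andP; split.
  rewrite leeBrDr//; apply: le_next_hit => s ats sn.
  have -> : s = (a + (s - a))%R by rewrite addrC subrK.
  rewrite -coord_shift; apply: (@lt_next_hit_notin _ _ F _ t).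
    by rewrite ltrBrDl.
  by rewrite EFinB lteBlDr.
apply: le_next_hit => s ts; rewrite lteBrDr// => sn.
rewrite coord_shift; apply: (@lt_next_hit_notin _ _ F _ (a + t)%R).
  by rewrite ltrD2l.
by rewrite EFinD addeC.
Qed.

Lemma hitting_time_shift a c : (0 <= a)%R -> a%:E < T c ->
  T (shift_path a c) = T c - a%:E.
Proof.
by move=> a0 aT; rewrite /hitting_time next_hit_shift addr0 (next_hit_const a0 aT).
Qed.

(** Its expectation under [P^x] is [Hf(x)]. *)
Definition hit_value (f : E -> \bar R) c : \bar R :=
  if T c < +oo then f (coord (fine (T c)) c) else 0.

(** Its expectation under [P^x] is [q(x)]. *)
Definition avoids c : \bar R := if T c == +oo then 1 else 0.

(** The one property of the endpoint functional that the argument relies on: along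
    an excursion, [Psi] can be read at any time before the end. *)
Definition unaffected_by_prehit_shift (Psi : paths R E -> \bar R) :=
  forall a c, (0 <= a)%R -> a%:E < T c -> Psi (shift_path a c) = Psi c.

Lemma hit_value_shift f : unaffected_by_prehit_shift (hit_value f).
Proof.
move=> a c a0 aT; rewrite /hit_value hitting_time_shift//.
case: (T c) aT => [r| |]//= _.
by rewrite -EFinD !ltry [(a + _)%R]addrC subrK.
Qed.

Lemma avoids_shift : unaffected_by_prehit_shift avoids.
Proof.
by move=> a c a0 aT; rewrite /avoids hitting_time_shift//; case: (T c) aT.
Qed.

Hypothesis hF : closed F.

Lemma hitting_time_gt0 c : ~ F (coord 0 c) -> 0 < T c.
Proof.
move=> nF; rewrite lt_neqAle next_hit_ge andbT; apply/eqP => T0.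
have [|r [rE _ Fr]] := @next_hit_fin _ _ F hF c 0%R.
  by rewrite -[X in X < _]T0 ltry.
by apply: nF; move: Fr; have -> : r = 0%R by move: rE; rewrite -[X in X = _ -> _]T0 => -[].
Qed.

Section straddling.
Variables (f : E -> \bar R) (Psi : paths R E -> \bar R).
Hypothesis hPsi : unaffected_by_prehit_shift Psi.

(** On the path reversed from a time [b] this is [f] at the start of the excursion
    straddling [b], provided that the start lies within [delta] of [b]. *)
Definition early_hit_value delta c : \bar R :=
  if `[< ~ F (coord 0 c) /\ T c <= delta%:E >] then hit_value f c else 0.

Definition excursion_value c s : \bar R := f (coord s c) * Psi (shift_path s c).

Definition straddling_starts (a b : R) c : set R :=
  [set s | [/\ (a <= s)%R, (s < b)%R, F (coord s c) & b%:E < nh c s]].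

(** The contribution of the excursion that starts at some [s] with
    [a <= s < a + delta] and straddles [a + delta], written as a functional of the
    path reversed from [a + delta] times a functional of the path after [a + delta]. *)
Definition straddling_value (a delta : R) c : \bar R :=
  early_hit_value delta (reverse_path delta (shift_path a c)) *
  Psi (shift_path (a + delta) c).

Lemma straddling_starts_unique a b c s s' :
  straddling_starts a b c s -> straddling_starts a b c s' -> s = s'.
Proof.
gen have H : s s' / straddling_starts a b c s -> straddling_starts a b c s' ->
   (s' <= s)%R.
  move=> [s1 s2 s3 s4] [s1' s2' s3' s4']; rewrite leNgt; apply/negP => ss'.
  apply: (@lt_next_hit_notin _ _ F c s s') => //.
  by apply: lt_trans s4; rewrite lte_fin.
by move=> hs hs'; apply/eqP; rewrite eq_le !H.
Qed.

(** The path reversed from [a + delta] first meets [F] at its time [a + delta - s],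
    and [F] is not met between [s] and [a + delta], so that [Psi] takes the same
    value from both times. *)
Lemma straddling_valueE a delta c s : straddling_starts a (a + delta) c s ->
  straddling_value a delta c = excursion_value c s.
Proof.
move=> [as_ sb Fs bs]; rewrite /straddling_value /excursion_value.
set c' := reverse_path _ _.
have c'E u : (0 <= u <= delta)%R -> coord u c' = coord (a + delta - u)%R c.
  move=> /andP[u0 ud]; rewrite coord_reverse coord_shift.
  by rewrite max_r ?subr_ge0// addrA.
have d0 : (0 < delta)%R by lra.
have Tc' : T c' = (a + delta - s)%:E.
  apply/eqP; rewrite eq_le; apply/andP; split.
    apply: next_hit_le; first lra.
    rewrite c'E; last lra.
    by rewrite opprB addrC subrK.
  apply: le_next_hit => u u0; rewrite lte_fin => us.
  rewrite c'E; last lra.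
  apply: (@lt_next_hit_notin _ _ F c s); first lra.
  by apply: le_lt_trans bs; rewrite lee_fin; lra.
congr (_ * _).
  rewrite /early_hit_value asboolT; last first.
    split; last by rewrite Tc' lee_fin; lra.
    rewrite c'E; last lra.
    by rewrite subr0; exact: (@lt_next_hit_notin _ _ F c s).
  rewrite /hit_value Tc' ltry [fine _]/= c'E; last lra.
  by rewrite opprB addrC subrK.
have -> : (a + delta)%R = (s + (a + delta - s))%R by lra.
rewrite -shift_shift hPsi//; first lra.
rewrite /hitting_time next_hit_shift addr0 lteBrDr//.
by rewrite -EFinD subrK.
Qed.

(** A nonzero value forces the reversed path to start off [F] and to meet it at some
    time [r] with [0 < r <= delta]; the excursion then starts at [a + delta - r]. *)
Lemma straddling_value_neq0 a delta c : straddling_value a delta c != 0 ->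
  exists s, straddling_starts a (a + delta) c s.
Proof.
rewrite /straddling_value; set c' := reverse_path _ _ => h.
have {h} : early_hit_value delta c' != 0.
  by apply: contra_neq h => ->; rewrite mul0e.
rewrite /early_hit_value; case: asboolP; last by rewrite eqxx.
move=> [nF Td _].
have Toy : T c' < +oo by apply: le_lt_trans Td _; rewrite ltry.
have [r [rE r0 Fr]] := next_hit_fin hF Toy.
have T0 := hitting_time_gt0 nF.
have rd : (r <= delta)%R by rewrite -lee_fin -rE.
have {}r0 : (0 < r)%R by rewrite -lte_fin -rE.
have c'E u : (0 <= u <= delta)%R -> coord u c' = coord (a + delta - u)%R c.
  move=> /andP[u0 ud]; rewrite coord_reverse coord_shift.
  by rewrite max_r ?subr_ge0// addrA.
have nFb : ~ F (coord (a + delta) c).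
  by move: nF; rewrite c'E ?subr0//; lra.
exists (a + delta - r)%R; split.
- lra.
- lra.
- by rewrite -c'E//; lra.
- rewrite lt_neqAle; apply/andP; split.
    apply/eqP => e; have [|q [qE _ Fq]] := @next_hit_fin _ _ F hF c (a + delta - r)%R.
      by rewrite -e ltry.
    by move: qE; rewrite -e => -[qE]; apply: nFb; rewrite qE.
  apply: le_next_hit => u u1; rewrite lte_fin => u2.
  have -> : u = (a + delta - (a + delta - u))%R by lra.
  rewrite -c'E; last lra.
  apply: (@lt_next_hit_notin _ _ F c' 0%R); first lra.
  by rewrite rE lte_fin; lra.
Qed.

Lemma straddling_value_esum a delta c :
  (forall s, 0 <= excursion_value c s) ->
  straddling_value a delta c =
  \esum_(s in straddling_starts a (a + delta) c) excursion_value c s.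
Proof.
move=> e0; have [[s hs]|h] := pselect (exists s, straddling_starts a (a + delta) c s).
  rewrite (straddling_valueE hs).
  have -> : straddling_starts a (a + delta) c = [set s].
    apply/seteqP; split=> [u hu|u ->//]; exact: straddling_starts_unique hu hs.
  by rewrite esum_set1.
have -> : straddling_starts a (a + delta) c = set0.
  by apply/seteqP; split=> // s hs; apply: h; exists s.
rewrite esum_set0; apply/eqP; apply: contrapT => /negP h'.
exact/h/straddling_value_neq0.
Qed.

End straddling.
End hitting_functionals.

(** * Measurability of hitting functionals *)

Section lusin.
Context (R : realType) (E : ptopologicalType).
Hypothesis hE : lusin_space R E.

Lemma borel_open (O : set E) : open O -> measurable (O : set (borel E)).
Proof. by move=> oO; exact: sub_gen_smallest. Qed.

Lemma borel_closed (F : set E) : closed F -> measurable (F : set (borel E)).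
Proof.
by move=> cF; rewrite -[F]setCK; apply: measurableC; apply: borel_open; exact: closed_openC.
Qed.

(** This is how metrizability is used: each point off [F] has a neighbourhood that
    misses some [O n], so countably many observations of a continuous path decide
    whether it meets [F]. *)
Lemma closed_nested_neighborhoods (F : set E) : closed F ->
  exists O : (set E)^nat,
    [/\ forall n, open (O n),
        forall n m, (n <= m)%N -> O m `<=` O n,
        forall n, F `<=` O n &
        forall x, ~ F x -> exists n, nbhs x (~` O n)].
Proof.
case: hE => K [h [_ _ _ hcont hopen]] cF.
have [U oU FU] := hopen _ (closed_openC cF).
pose B n : set K := \bigcup_(z in ~` U) (ball z n.+1%:R^-1)°.
exists (fun n => h @^-1` B n); split.
- move=> n; apply: open_comp; first by move=> x _; exact: hcont.
  by apply: bigcup_open => z _; exact: open_interior.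
- move=> n m nm; apply: preimage_subset; apply: subset_bigcup => z _.
  apply: interiorS; apply: le_ball.
  by rewrite lef_pV2 ?posrE ?ltr0n// ler_nat.
- move=> n x Fx; exists (h x) => /=.
    by move=> Uhx; have : (h @^-1` U) x by []; rewrite -FU; exact.
  by apply: nbhsx_ballx; rewrite invr_gt0 ltr0n.
- move=> x nFx.
  have Uhx : U (h x) by have : (~` F) x by []; rewrite FU.
  have : nbhs (h x) U by exact: open_nbhs_nbhs.
  rewrite -nbhs_ballE => -[e /= e0 eU].
  have [n nV] : exists n, (n.+1%:R^-1 < e / 2)%R.
    exists (Num.truncn (e / 2)^-1).
    by rewrite invf_plt ?posrE ?divr_gt0 ?ltr0n// truncnS_gt.
  exists n; have : nbhs (h x) (ball (h x) (e / 2)%R).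
    by apply: nbhsx_ballx; exact: divr_gt0.
  move=> /(hcont x) hh.
  apply: (@filterS _ (nbhs x) _ _ _ _ hh) => y /= hy [z /= nUz /interior_subset zy].
  apply: nUz; apply: eU; rewrite [e]splitr; apply: (ball_triangle hy).
  by apply: ball_sym; apply: le_ball zy; exact: ltW.
Qed.

(** By compactness, a continuous path that misses [F] on the segment misses one of the
    nested neighbourhoods of [F] on it.  Hence the segment contains a hit if and
    only if each neighbourhood is visited at some time of a countable dense subset of the segment. *)
Lemma measurable_hit_in_segment (F : set E) (a b : R) : closed F -> (0 <= a)%R ->
  measurable [set c : paths R E | exists s, (a <= s <= b)%R /\ F (coord s c)].
Proof.
move=> cF a0; have [ba|ab] := ltP b a.
  rewrite (_ : [set _ | _] = set0)//; apply/seteqP; split=> // c [s [+ _]].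
  by move=> /andP[sa sb]; have := le_trans sa sb; rewrite leNgt ba.
have [V [oO Omon FO Osep]] := closed_nested_neighborhoods cF.
(* the rationals, moved into the segment *)
pose q (r : rat) : R := Order.max a (Order.min b (ratr r)).
have qab r : (a <= q r <= b)%R by rewrite /q le_max lexx/= ge_max ab ge_min lexx.
rewrite (_ : [set _ | _] =
    \bigcap_n \bigcup_(r in [set: rat]) [set c : paths R E | V n (coord (q r) c)]); last first.
  apply/seteqP; split=> c.
    move=> [s [/andP[as_ sb] Fs]] n _.
    have : nbhs s ((fun s => coord s c) @^-1` V n).
      by apply: coord_continuous; apply: open_nbhs_nbhs; split => //; exact: FO.
    move=> [e /= e0 he].
    have se : (s - e < s + e)%R by lra.
    have [r] := rat_in_itvoo se.
    rewrite in_itv/= => /andP[r1 r2]; exists r => //=.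
    apply: he => /=; rewrite /q.
    rewrite distrC ltr_distl; apply/andP; split.
      by rewrite lt_max lt_min; apply/orP; right; lra.
    by rewrite gt_max gt_min; apply/andP; split; [lra|apply/orP; right; lra].
  move=> h; apply: contrapT => nh.
  have : near_covering `[a, b]%classic.
    by apply/compact_near_coveringP; exact: segment_compact.
  move=> /(_ nat \oo (fun n s => ~ V n (coord s c)) _)[].
    move=> s /=; rewrite in_itv/= => sab.
    have [n0 hn0] := Osep (coord s c) (fun Fs => nh (ex_intro _ s (conj sab Fs))).
    have : nbhs s ((fun s => coord s c) @^-1` (~` V n0)) by exact: coord_continuous.
    move=> hs; exists ((fun s => coord s c) @^-1` (~` V n0), [set n | (n0 <= n)%N]).
      by split => //=; exists n0.
    by move=> [u n] /= [hu n0n] Onu; apply: hu; exact: (Omon _ _ n0n).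
  move=> N _ /(_ N (leqnn N)) hN.
  by have [r _ /= Or] := h N I; apply: (hN (q r)) => //=; rewrite in_itv/= qab.
apply: bigcapT_measurable => n; apply: bigcupT_measurable_rat => r.
rewrite -[X in measurable X]setTI.
apply: measurable_coord => //; last exact: borel_open.
by have /andP[+ _] := qab r; exact: le_trans.
Qed.

End lusin.

Section path_measurability.
Context (R : realType) (E : ptopologicalType).
Hypothesis hE : lusin_space R E.

Lemma measurable_retime (tau : R -> R) (htau : continuous tau) :
  (forall s, (0 <= s)%R -> (0 <= tau s)%R) ->
  measurable_fun [set: paths R E] (@retime R E tau htau).
Proof.
by move=> tau0; apply: measurable_fun_paths => s s0; exact: measurable_coord (tau0 s s0).
Qed.

Lemma measurable_shift_path (a : R) : (0 <= a)%R ->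
  measurable_fun [set: paths R E] (@shift_path R E a).
Proof. by move=> a0; apply: measurable_retime => s s0; exact: addr_ge0. Qed.

Lemma measurable_stop_path (a : R) : (0 <= a)%R ->
  measurable_fun [set: paths R E] (@stop_path R E a).
Proof. by move=> a0; apply: measurable_retime => s s0; rewrite le_min s0. Qed.

Lemma measurable_reverse_path (a : R) :
  measurable_fun [set: paths R E] (@reverse_path R E a).
Proof. by apply: measurable_retime => s s0; rewrite le_max lexx. Qed.

(** The time [sigma] is approximated by grid times [floor((n + 1) sigma) / (n + 1)],
    which take countably many values, and membership of the limit in a closed set
    is tested on its nested neighbourhoods. *)
Lemma measurable_coord_at (sigma : paths R E -> R) :
  (forall c, (0 <= sigma c)%R) -> measurable_fun [set: paths R E] sigma ->
  measurable_fun [set: paths R E] (fun c => coord (sigma c) c : borel E).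
Proof.
move=> s0 ms.
pose D n (c : paths R E) : R := ((Num.truncn (n.+1%:R * sigma c))%:R / n.+1%:R)%R.
have mD n : measurable_fun [set: paths R E] (fun c => coord (D n c) c : borel E).
  move=> _ B mB; rewrite setTI.
  rewrite (_ : _ @^-1` B = \bigcup_k
    ([set c | (k%:R <= n.+1%:R * sigma c < k.+1%:R)%R] `&`
     [set c | B (coord (k%:R / n.+1%:R)%R c)])); last first.
    apply/seteqP; split=> c /=.
      move=> Bc; exists (Num.truncn (n.+1%:R * sigma c)) => //; split => //=.
      by apply: truncn_itv; rewrite mulr_ge0// ler0n.
    by move=> [k _ [/= /truncn_def <-]].
  apply: bigcupT_measurable => k; apply: measurableI; last first.
    rewrite -[X in measurable X]setTI; apply: measurable_coord => //.
  have mf : measurable_fun [set: paths R E] (fun c => (n.+1%:R * sigma c)%R).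
    by apply: measurable_funM; [exact: measurable_cst|exact: ms].
  have := mf measurableT _ (measurable_itv `[k%:R, k.+1%:R[).
  by rewrite setTI; congr (measurable _); apply/seteqP; split => c; rewrite /= in_itv.
have Dcvg c : D n c @[n --> \oo] --> sigma c.
  apply/cvgrPdist_lt => e e0; near=> n.
  have n0 : (0 < n.+1%:R :> R)%R by rewrite ltr0n.
  have /truncn_itv/andP[h1 h2] : (0 <= n.+1%:R * sigma c)%R by rewrite mulr_ge0.
  have k1 : (D n c <= sigma c)%R by rewrite /D ler_pdivrMr// [leRHS]mulrC.
  rewrite ger0_norm ?subr_ge0//.
  apply: (@le_lt_trans _ _ n.+1%:R^-1%R).
    rewrite lerBlDl /D.
    rewrite -[leRHS](_ : ((Num.truncn (n.+1%:R * sigma c))%:R + 1) / n.+1%:R = _)%R; last first.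
      by rewrite mulrDl mul1r.
    by rewrite ler_pdivlMr// [leLHS]mulrC natr1 ltW.
  by near: n; exact: near_infty_natSinv_lt (PosNum e0).
have closedP (F : set E) : closed F ->
    measurable [set c : paths R E | F (coord (sigma c) c)].
  move=> cF; have [V [oV Vmon FV Vsep]] := closed_nested_neighborhoods hE cF.
  rewrite (_ : [set _ | _] = \bigcap_n \bigcup_N \bigcap_(k in [set k | (N <= k)%N])
      [set c | V n (coord (D k c) c)]); last first.
    have cD c : coord (D n c) c @[n --> \oo] --> coord (sigma c) c.
      by apply: (cvg_comp _ _ (Dcvg c)); exact: coord_continuous.
    apply/seteqP; split => c /=.
      move=> Fc n _.
      have : nbhs (coord (sigma c) c) (V n).
        by apply: open_nbhs_nbhs; split => //; exact: FV.
      by move=> /cD[N _ hN]; exists N => // k /= Nk; exact: hN.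
    move=> h; apply: contrapT => /Vsep[n /cD[N _ hN]].
    have [M _ hM] := h n I.
    apply: (hN (maxn N M)); first by rewrite /= leq_maxl.
    by apply: hM; rewrite /= leq_maxr.
  apply: bigcapT_measurable => n; apply: bigcupT_measurable => N.
  apply: bigcap_measurable; first by exists N => /=.
  move=> k _; rewrite -[X in measurable X]setTI; apply: mD => //.
  exact: borel_open.
apply: (@measurability _ _ _ (borel E) _ _ (@open E)) => // _ [B oB <-].
rewrite setTI -[X in measurable X]setCK; apply: measurableC.
exact: closedP (open_closedC oB).
Unshelve. all: by end_near. Qed.

Variables (F : set E).
Hypothesis hF : closed F.
Local Notation T c := (hitting_time (@coord R E) F c).

Lemma measurable_hitting_time :
  measurable_fun [set: paths R E] (hitting_time (@coord R E) F).
Proof.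
apply: (measurability _ (ErealGenInftyO.measurableE R)) => _ [_ [r ->] <-].
rewrite setTI (_ : _ @^-1` _ = \bigcup_n [set c : paths R E | exists s,
   (n.+1%:R^-1 <= s <= r - n.+1%:R^-1)%R /\ F (coord s c)]).
  by apply: bigcupT_measurable => n; apply: measurable_hit_in_segment.
apply/seteqP; split=> c /=.
  rewrite in_itv/= => /next_hit_lt_ex[s [s0 sr Fs]].
  have [n hn] : exists n, (n.+1%:R^-1 < Order.min s (r - s)%R)%R.
    exists (Num.truncn (Order.min s (r - s)%R)^-1).
    by rewrite invf_plt ?posrE ?ltr0n ?truncnS_gt// lt_min s0 subr_gt0.
  exists n => //; exists s; split=> //.
  move: hn; rewrite lt_min => /andP[h1 h2]; rewrite (ltW h1)/=.
  by rewrite lerBrDl -lerBrDr ltW.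
move=> [n _ [s [/andP[s1 s2] Fs]]]; rewrite in_itv/=.
have n0 : (0 < n.+1%:R^-1 :> R)%R by rewrite invr_gt0.
apply: (@le_lt_trans _ _ s%:E); last first.
  by rewrite lte_fin; apply: le_lt_trans s2 _; rewrite ltrBlDr ltrDl.
by apply: next_hit_le => //; exact: lt_le_trans s1.
Qed.

Lemma measurable_fun_hitting_time_in (B : set (\bar R)) : measurable B ->
  measurable_fun [set: paths R E] (fun c => T c \in B).
Proof.
move=> mB; apply: (@measurable_fun_bool _ _ _ _ true); rewrite setTI.
rewrite (_ : _ @^-1` _ = (hitting_time (@coord R E) F) @^-1` B); last first.
  by apply/seteqP; split => c; [exact: set_mem|exact: mem_set].
rewrite -[X in measurable X]setTI; exact: measurable_hitting_time.
Qed.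

Lemma measurable_hit_value (f : borel E -> \bar R) :
  measurable_fun [set: borel E] f ->
  measurable_fun [set: paths R E] (hit_value F f).
Proof.
move=> mf; apply: measurable_fun_ifT.
- rewrite (_ : (fun c => _) = (fun c => ~~ (T c \in [set +oo]))); last first.
    by apply/funext => c; rewrite in_set1 ltey.
  apply: measurable_neg.
  exact: measurable_fun_hitting_time_in.
- apply: (measurableT_comp mf (_ : measurable_fun _ (fun c => coord (fine (T c)) c : borel E))).
  apply: measurable_coord_at.
    by move=> c; apply: fine_ge0; exact: next_hit_ge.
  by apply: measurableT_comp => //; exact: measurable_hitting_time.
- exact: measurable_cst.
Qed.

Lemma measurable_avoids : measurable_fun [set: paths R E] (avoids F).
Proof.
rewrite /avoids; apply: measurable_fun_ifT => //.
rewrite (_ : (fun c => _) = (fun c => T c \in [set +oo])); last first.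
  by apply/funext => c; rewrite in_set1.
exact: measurable_fun_hitting_time_in.
Qed.

Lemma measurable_early_hit_value (f : borel E -> \bar R) (delta : R) :
  measurable_fun [set: borel E] f ->
  measurable_fun [set: paths R E] (early_hit_value F f delta).
Proof.
move=> mf; apply: measurable_fun_ifT; last 2 first.
- exact: measurable_hit_value.
- exact: measurable_cst.
rewrite (_ : (fun c => _) = (fun c =>
    (coord 0%R c \in ~` F) && (T c \in `]-oo, delta%:E]%classic))); last first.
  apply/funext => c; apply/asboolP/andP => -[h1 h2]; split.
  - exact: mem_set.
  - by apply: mem_set; rewrite /= in_itv.
  - exact: (set_mem h1).
  - by have := set_mem h2; rewrite /= in_itv.
apply: measurable_and; last exact: measurable_fun_hitting_time_in (emeasurable_itv _).
apply: (measurable_fun_bool true); rewrite setTI.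
rewrite (_ : _ @^-1` _ = coord 0%R @^-1` (~` F)); last first.
  by apply/seteqP; split => c; [exact: set_mem|exact: mem_set].
rewrite -[X in measurable X]setTI; apply: measurable_coord => //.
by apply: borel_open; exact: closed_openC.
Qed.

Lemma measurable_straddling_value (f : borel E -> \bar R) Psi (a delta : R) :
  (0 <= a)%R -> (0 <= delta)%R ->
  measurable_fun [set: borel E] f ->
  measurable_fun [set: paths R E] Psi ->
  measurable_fun [set: paths R E] (straddling_value F f Psi a delta).
Proof.
move=> a0 d0 mf mPsi; apply: emeasurable_funM.
  apply: (measurableT_comp (measurable_early_hit_value delta mf)).
  apply: (measurableT_comp (measurable_reverse_path delta)).
  exact: measurable_shift_path a0.
by apply: (measurableT_comp mPsi); apply: measurable_shift_path; exact: addr_ge0.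
Qed.

End path_measurability.

(** * Positive functionals and their uniqueness *)

(** Monotonicity removes the indeterminate case [0 * oo]: a nonnegative
    nondecreasing sequence with limit [0] is identically [0]. *)
Lemma cvgeM_nondecreasing (R : realType) (f g : (\bar R)^nat) (a b : \bar R) :
  (forall n, 0 <= f n) -> (forall n, 0 <= g n) ->
  nondecreasing_seq f -> nondecreasing_seq g ->
  f n @[n --> \oo] --> a -> g n @[n --> \oo] --> b ->
  f n * g n @[n --> \oo] --> a * b.
Proof.
have zero (h : (\bar R)^nat) c : (forall n, 0 <= h n) -> nondecreasing_seq h ->
    h n @[n --> \oo] --> c -> c = 0 -> h = cst 0.
  move=> h0 nd hc c0; apply/funext => n; apply/eqP; rewrite eq_le h0 andbT.
  rewrite -[leRHS]c0 -(cvg_lim _ hc)//.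
  rewrite (cvg_lim _ (ereal_nondecreasing_cvgn nd))//.
  by apply: ereal_sup_ubound; exists n.
move=> f0 g0 ndf ndg fa gb.
have [a0|a0] := eqVneq a 0.
  rewrite (zero _ _ f0 ndf fa a0) a0 mul0e (_ : (fun n => _) = cst 0); first exact: cvg_cst.
  by apply/funext => n; rewrite mul0e.
have [b0|b0] := eqVneq b 0.
  rewrite (zero _ _ g0 ndg gb b0) b0 mule0 (_ : (fun n => _) = cst 0); first exact: cvg_cst.
  by apply/funext => n; rewrite mule0.
by apply: cvgeM => //; rewrite mule_defE (negbTE a0) (negbTE b0).
Qed.

Section positive_functionals.
Context (R : realType).

(** Integrals and iterated integrals such as [int (int f dP^x) m(dx)], in which no
    single measure is visible, are thereby treated alike. *)
Record positive_functional d (T : measurableType d) (L : (T -> \bar R) -> \bar R) := {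
  pf_ge0 : forall f, (forall x, 0 <= f x) -> 0 <= L f;
  pf_scale : forall k f, (0 <= k)%R -> measurable_fun [set: T] f ->
    (forall x, 0 <= f x) -> L (fun x => k%:E * f x) = k%:E * L f;
  pf_add : forall f g, measurable_fun [set: T] f -> measurable_fun [set: T] g ->
    (forall x, 0 <= f x) -> (forall x, 0 <= g x) ->
    L (fun x => f x + g x) = L f + L g;
  pf_lim : forall (f : (T -> \bar R)^nat) (g : T -> \bar R),
    (forall n, measurable_fun [set: T] (f n)) -> (forall n x, 0 <= f n x) ->
    (forall x, nondecreasing_seq (f ^~ x)) ->
    (forall x, f n x @[n --> \oo] --> g x) -> L (f n) @[n --> \oo] --> L g }.

Definition indicator d (T : measurableType d) (A : set T) (x : T) : \bar R := (\1_A x)%:E.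

Lemma indicator_ge0 d (T : measurableType d) (A : set T) x : 0 <= indicator A x.
Proof. by rewrite lee_fin. Qed.

Lemma measurable_indicator d (T : measurableType d) (A : set T) :
  measurable A -> measurable_fun [set: T] (indicator A).
Proof. by move=> mA; apply/measurable_EFinP; exact: measurable_indic. Qed.

Section functional_theory.
Context d (T : measurableType d) (L : (T -> \bar R) -> \bar R).
Hypothesis hL : positive_functional L.

Lemma pf_0 : L (fun=> 0) = 0.
Proof.
have := pf_scale hL (lexx 0%R) (measurable_cst (0 : \bar R)) (fun=> lexx _).
by rewrite mul0e => {2}<-; congr L; apply/funext => x; rewrite mul0e.
Qed.

Lemma pf_sum (I : Type) (s : seq I) (h : I -> T -> \bar R) :
  (forall i, measurable_fun [set: T] (h i)) -> (forall i x, 0 <= h i x) ->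
  L (fun x => \sum_(i <- s) h i x) = \sum_(i <- s) L (h i).
Proof.
move=> mh h0; elim: s => [|i s IH].
  rewrite big_nil -[RHS]pf_0; congr L.
  by apply/funext => x; rewrite big_nil.
rewrite big_cons -IH -pf_add//; last 2 first.
- exact: emeasurable_sum.
- by move=> x; exact: sume_ge0.
by congr L; apply/funext => x; rewrite big_cons.
Qed.

Definition functional_measure (A : set T) : \bar R := L (indicator A).

Let functional_measure0 : functional_measure set0 = 0.
Proof.
by rewrite -[RHS]pf_0; congr L; apply/funext => x; rewrite /indicator indic0.
Qed.

Let functional_measure_ge0 A : 0 <= functional_measure A.
Proof. by apply: (pf_ge0 hL) => x; exact: indicator_ge0. Qed.

Let functional_measure_sigma_additive : semi_sigma_additive functional_measure.
Proof.
move=> A mA tA mUA; rewrite (_ : (fun n => _) =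
    (fun n => L (fun x => \sum_(0 <= i < n) indicator (A i) x))); last first.
  apply/funext => n; rewrite pf_sum// => i; last by move=> x; exact: indicator_ge0.
  exact: measurable_indicator.
apply: (@pf_lim _ _ _ hL (fun n x => \sum_(0 <= i < n) indicator (A i) x)).
- by move=> n; apply: emeasurable_sum => i; exact: measurable_indicator.
- by move=> n x; apply: sume_ge0 => i _; exact: indicator_ge0.
- by move=> x; apply: ereal_nondecreasing_series => i _ _; exact: indicator_ge0.
move=> x; have := @measure_semi_sigma_additive _ _ _ (\d_x) A mA tA mUA.
exact.
Qed.

HB.instance Definition _ := isMeasure.Build d T R functional_measure
  functional_measure0 functional_measure_ge0 functional_measure_sigma_additive.

(** This is what lets the uniqueness theorem for measures compare functionals. *)
Definition measure_of_functional : {measure set T -> \bar R} := functional_measure.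

End functional_theory.

Import HBNNSimple.

Lemma pf_eq_on_measurable_sets d (T : measurableType d) (L1 L2 : (T -> \bar R) -> \bar R) :
  positive_functional L1 -> positive_functional L2 ->
  (forall A, measurable A -> L1 (indicator A) = L2 (indicator A)) ->
  forall f, measurable_fun [set: T] f -> (forall x, 0 <= f x) -> L1 f = L2 f.
Proof.
move=> h1 h2 h12 f mf f0.
pose f_ := nnsfun_approx measurableT mf.
have simple (L : (T -> \bar R) -> \bar R) : positive_functional L -> forall n,
    L (fun x => (f_ n x)%:E) =
    \sum_(r <- fset_set (range (f_ n))) `|r|%:E * L (indicator (f_ n @^-1` [set r])).
  move=> hL n.
  rewrite (_ : (fun x => _) = (fun x => \sum_(r <- fset_set (range (f_ n)))
      `|r|%:E * indicator (f_ n @^-1` [set r]) x)).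
    rewrite (pf_sum hL)//.
    - apply: eq_bigr => r _; rewrite (pf_scale hL)//.
        exact: measurable_indicator.
      by move=> x; exact: indicator_ge0.
    - by move=> r; apply: emeasurable_funM => //; exact: measurable_indicator.
    - by move=> r x; apply: mule_ge0; [rewrite lee_fin|exact: indicator_ge0].
  apply/funext => x; rewrite [in LHS]fimfunE fsbig_finite//= -sumEFin.
  rewrite big_seq [RHS]big_seq; apply: eq_bigr => r.
  rewrite in_fset_set// => /set_mem[y _ <-]; rewrite /indicator -EFinM.
  by rewrite ger0_norm.
have cvgL (L : (T -> \bar R) -> \bar R) : positive_functional L ->
    L (fun x => (f_ n x)%:E) @[n --> \oo] --> L f.
  move=> hL; apply: (pf_lim hL).
  - by move=> n; exact/measurable_EFinP.
  - by move=> n x; rewrite lee_fin.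
  - by move=> x a b ab; rewrite lee_fin; exact/lefP/nd_nnsfun_approx.
  - by move=> x; exact: cvg_nnsfun_approx.
have := cvgL _ h1; rewrite (_ : (fun n => _) = (fun n => L2 (fun x => (f_ n x)%:E))).
  by move=> c1; apply: cvg_unique c1 (cvgL _ h2); exact: ereal_hausdorff.
apply/funext => n; rewrite (simple _ h1) (simple _ h2).
by apply: eq_bigr => r _; rewrite h12.
Qed.

(** The pi-lambda theorem gives equality on indicators, and approximation by simple
    functions gives the rest. *)
Lemma pf_eq_on_pi_system d (T : measurableType d) (G : set (set T)) (g : (set T)^nat)
    (L1 L2 : (T -> \bar R) -> \bar R) :
  positive_functional L1 -> positive_functional L2 ->
  measurable = <<s G >> -> setI_closed G ->
  (forall n, G (g n)) -> \bigcup_n g n = setT ->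
  (forall A, G A -> L1 (indicator A) = L2 (indicator A)) ->
  (forall n, L1 (indicator (g n)) < +oo) ->
  forall f, measurable_fun [set: T] f -> (forall x, 0 <= f x) -> L1 f = L2 f.
Proof.
move=> h1 h2 mG GI Gg gT h12 goo; apply: (pf_eq_on_measurable_sets h1 h2) => A mA.
exact: (@measure_unique _ _ _ G g mG GI Gg gT (measure_of_functional h1)
  (measure_of_functional h2)).
Qed.

Lemma weighted_integral_functional d d' (T : measurableType d) (S : measurableType d')
    (mu : {measure set S -> \bar R}) (Z : S -> T) (k : S -> \bar R) :
  measurable_fun [set: S] Z -> measurable_fun [set: S] k -> (forall w, 0 <= k w) ->
  positive_functional (fun f : T -> \bar R => \int[mu]_w (f (Z w) * k w)).
Proof.
move=> mZ mk k0.
have mfk (f : T -> \bar R) : measurable_fun [set: T] f ->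
    measurable_fun [set: S] (fun w => f (Z w) * k w).
  by move=> mf; apply: emeasurable_funM => //; exact: measurableT_comp mf mZ.
split.
- by move=> f f0; apply: integral_ge0 => w _; exact: mule_ge0.
- move=> r f r0 mf f0; under eq_integral do rewrite -muleA.
  rewrite ge0_integralZl//; first exact: mfk.
  by move=> w _; exact: mule_ge0.
- move=> f g mf mg f0 g0; under eq_integral do rewrite ge0_muleDl//.
  rewrite ge0_integralD//; try exact: mfk.
    by move=> w _; exact: mule_ge0.
  by move=> w _; exact: mule_ge0.
- move=> f g mf f0 nd fg.
  rewrite (_ : \int[mu]_w (g (Z w) * k w) =
    \int[mu]_w limn (fun n => f n (Z w) * k w)).
    apply: cvg_monotone_convergence => //.
    + by move=> n; exact: mfk.
    + by move=> n w _; exact: mule_ge0.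
    + by move=> w _ a b ab; apply: lee_pmul => //; exact: nd.
  apply: eq_integral => w _; apply/esym/cvg_lim => //.
  by apply: cvgeM_nondecreasing => //; exact: cvg_cst.
Qed.

Lemma iterated_integral_functional d1 d2 d3 d4 (T : measurableType d1)
    (S : measurableType d2) (U : measurableType d3) (V : measurableType d4)
    (mu : {measure set S -> \bar R}) (kappa : R.-pker U ~> V) (y : S -> U) (Z : V -> T)
    (k : S -> \bar R) :
  measurable_fun [set: S] y -> measurable_fun [set: V] Z ->
  measurable_fun [set: S] k -> (forall w, 0 <= k w) ->
  positive_functional
    (fun f : T -> \bar R => \int[mu]_w (\int[kappa (y w)]_v f (Z v) * k w)).
Proof.
move=> my mZ mk k0.
have hin u : positive_functional (fun f : T -> \bar R => \int[kappa u]_v f (Z v)).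
  have := weighted_integral_functional (kappa u) mZ (measurable_cst 1) (fun=> lee01).
  congr positive_functional; apply/funext => f; apply: eq_integral => v _.
  by rewrite mule1.
have mout (f : T -> \bar R) : measurable_fun [set: T] f -> (forall x, 0 <= f x) ->
    measurable_fun [set: U] (fun u => \int[kappa u]_v f (Z v)).
  move=> mf f0; apply: measurable_fun_integral_kernel => //.
    by move=> B mB; exact: measurable_kernel.
  exact: measurableT_comp mf mZ.
have hout := weighted_integral_functional mu my mk k0.
have in0 (f : T -> \bar R) : (forall x, 0 <= f x) ->
    forall u, 0 <= \int[kappa u]_v f (Z v).
  by move=> f0 u; exact: integral_ge0.
split.
- move=> f f0; apply: integral_ge0 => w _; apply: mule_ge0 => //.
  exact: integral_ge0.
- move=> r f r0 mf f0.
  have /= <- := pf_scale hout r0 (mout f mf f0) (in0 f f0).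
  by apply: eq_integral => w _; rewrite (pf_scale (hin _)).
- move=> f g mf mg f0 g0.
  have /= <- := pf_add hout (mout f mf f0) (mout g mg g0) (in0 f f0) (in0 g g0).
  by apply: eq_integral => w _; rewrite (pf_add (hin _)).
- move=> f g mf f0 nd fg.
  apply: (@pf_lim _ _ _ hout (fun n u => \int[kappa u]_v f n (Z v))
    (fun u => \int[kappa u]_v g (Z v))).
  + by move=> n; exact: mout.
  + by move=> n u; exact: integral_ge0.
  + move=> u a b ab; apply: ge0_le_integral => //.
    * exact: measurableT_comp (mf a) mZ.
    * exact: measurableT_comp (mf b) mZ.
    * by move=> v _; exact: nd.
  + by move=> u; exact: (pf_lim (hin u)).
Qed.

End positive_functionals.

Arguments indicator {R d T} A x.
Arguments indicator_ge0 {R d T} A x.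
Arguments measurable_indicator {R d T A} mA : rename.

(** * Finite-dimensional laws of the process *)

Section process_law.
Context (R : realType) (E : ptopologicalType).
Hypothesis hE : lusin_space R E.

Lemma borel_set1 (x : E) : measurable ([set x] : set (borel E)).
Proof.
case: hE => K [h [_ _ hinj hcont _]]; apply: borel_closed.
rewrite (_ : [set x] = h @^-1` [set h x]).
  apply: preimage_closed; first by move=> y _; exact: hcont.
  by apply: accessible_closed_set1; apply: hausdorff_accessible; exact: metric_hausdorff.
by apply/seteqP; split => [y -> //|y /= /hinj].
Qed.

(** The sets are indexed by time and not by position in the list, so that a
    cylinder does not depend on the order in which its times are listed. *)
Definition finite_cylinder (ts : seq R) (B : R -> set E) : set (paths R E) :=
  [set c | forall s, s \in ts -> B s (coord s c)].

Definition finite_cylinders : set (set (paths R E)) :=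
  [set A | exists ts (B : R -> set (borel E)),
    [/\ forall s, s \in ts -> (0 <= s)%R, forall s, measurable (B s) &
        A = finite_cylinder ts B]].

Lemma measurable_finite_forall (I : eqType) (ts : seq I) d (T : measurableType d)
    (A : I -> set T) : (forall s, s \in ts -> measurable (A s)) ->
  measurable [set w | forall s, s \in ts -> A s w].
Proof.
elim: ts => [|s ts IH] h.
  rewrite (_ : [set _ | _] = setT)//; exact/seteqP.
rewrite (_ : [set _ | _] = A s `&` [set w | forall u, u \in ts -> A u w]).
  apply: measurableI; first by apply: h; rewrite mem_head.
  by apply: IH => u uts; apply: h; rewrite in_cons uts orbT.
apply/seteqP; split => w /=.
  move=> H; split; first by apply: H; rewrite mem_head.
  by move=> u uts; apply: H; rewrite in_cons uts orbT.
by move=> [H1 H2] u; rewrite in_cons => /orP[/eqP ->//|]; exact: H2.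
Qed.

Lemma setI_closed_finite_cylinders : setI_closed finite_cylinders.
Proof.
move=> _ _ [ts [B [ts0 mB ->]]] [us [C [us0 mC ->]]].
exists (ts ++ us), (fun s => (if s \in ts then B s else setT) `&`
  (if s \in us then C s else setT)); split.
- by move=> s; rewrite mem_cat => /orP[/ts0|/us0].
- by move=> s; apply: measurableI; case: ifP.
apply/seteqP; split=> c.
  by move=> [h1 h2] s _; split; case: ifP => // h; [exact: h1|exact: h2].
by move=> h; split=> s sts; have := h s; rewrite mem_cat sts ?orbT => /(_ isT)[].
Qed.

Lemma measurable_finite_cylindersE :
  (measurable : set (set (paths R E))) = <<s finite_cylinders >>.
Proof.
apply/seteqP; split.
  apply: smallest_sub; first exact: smallest_sigma_algebra.
  move=> _ [s [B [s0 mB ->]]]; apply: sub_gen_smallest.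
  exists [:: s], (fun=> B); split => //.
    by move=> u; rewrite inE => /eqP ->.
  apply/seteqP; split => c; first by move=> Bc u; rewrite inE => /eqP ->.
  by apply; rewrite mem_head.
apply: smallest_sub; first exact: sigma_algebra_measurable.
move=> _ [ts [B [ts0 mB ->]]].
apply: (@measurable_finite_forall _ ts _ (paths R E)
  (fun s => [set c : paths R E | B s (coord s c)])) => s /ts0 s0.
by rewrite -[X in measurable X]setTI; exact: measurable_coord.
Qed.

Context (d : measure_display) (Omega : measurableType d)
  (X : R -> Omega -> E) (theta : R -> Omega -> Omega)
  (P : R.-pker (borel E) ~> Omega).
Hypothesis hX : conservative_borel_right_process X theta P.
Hypothesis hcont : continuous_paths X.

Lemma sample_path_continuous w : continuous (fun s : R => X (Order.max 0%R s) w).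
Proof.
move=> s U /= hU.
have max0 : (0 <= Order.max 0%R s)%R by rewrite le_max lexx.
have := @hcont w (Order.max 0%R s).
move=> /(_ U hU) h0.
have h : within [set t | (0 <= t)%R] (nbhs (Order.max 0%R s)) (X ^~ w @^-1` U).
  by rewrite nbhs_subspace_in//.
have mc : continuous (fun s : R => Order.max 0%R s).
  by move=> u; apply: (@continuous_max R R (cst 0%R) id); [exact: cvg_cst|exact: cvg_id].
have hh := mc s _ h.
apply: (@filterS _ (nbhs s) _ _ _ _ hh) => u /=; apply.
by rewrite /= le_max lexx.
Qed.

Definition sample_path (w : Omega) : paths R E := Path (@sample_path_continuous w).

Lemma coord_sample_path s w : (0 <= s)%R -> coord s (sample_path w) = X s w.
Proof. by move=> s0; rewrite /coord /= max_r. Qed.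

Lemma measurable_process s : (0 <= s)%R ->
  measurable_fun [set: Omega] (X s : Omega -> borel E).
Proof. exact: (brp_measurable hX). Qed.

Lemma measurable_sample_path : measurable_fun [set: Omega] sample_path.
Proof.
apply: measurable_fun_paths => s s0.
rewrite (_ : (fun w => _) = (X s : Omega -> borel E)).
  exact: measurable_process.
by apply/funext => w; rewrite coord_sample_path.
Qed.

Lemma natural_filtration_sigma_algebra t :
  sigma_algebra setT (natural_filtration X t).
Proof. exact: smallest_sigma_algebra. Qed.

Lemma natural_filtration_measurable t A : natural_filtration X t A -> measurable A.
Proof.
have : natural_filtration X t `<=` measurable.
  apply: smallest_sub; first exact: sigma_algebra_measurable.
  move=> _ [s [B [/andP[s0 _] mB ->]]].
  by rewrite -[X in measurable X]setTI; exact: measurable_process.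
exact.
Qed.

Lemma natural_filtration_le s t : (s <= t)%R ->
  natural_filtration X s `<=` natural_filtration X t.
Proof.
move=> st; apply: smallest_sub; first exact: smallest_sigma_algebra.
move=> _ [u [B [/andP[u0 us] mB ->]]]; apply: sub_gen_smallest.
by exists u, B; split => //; rewrite u0 (le_trans us st).
Qed.

Lemma natural_filtration_coord s t (B : set (borel E)) : (0 <= s <= t)%R ->
  measurable B -> natural_filtration X t (X s @^-1` B).
Proof. by move=> st mB; apply: sub_gen_smallest; exists s, B. Qed.

Lemma natural_filtrationI t A B : natural_filtration X t A ->
  natural_filtration X t B -> natural_filtration X t (A `&` B).
Proof.
move=> hA hB.
pose T := g_sigma_algebraType [set A | exists s (B : set (borel E)),
        [/\ (0 <= s <= t)%R, measurable B & A = X s @^-1` B]].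
exact: (@measurableI _ T).
Qed.

Lemma natural_filtrationT t : natural_filtration X t setT.
Proof.
pose T := g_sigma_algebraType [set A | exists s (B : set (borel E)),
        [/\ (0 <= s <= t)%R, measurable B & A = X s @^-1` B]].
exact: (@measurableT _ T).
Qed.

Lemma measurable_expectation (f : Omega -> \bar R) :
  measurable_fun [set: Omega] f -> (forall w, 0 <= f w) ->
  measurable_fun [set: borel E] (fun x => \int[P x]_w f w).
Proof.
move=> mf f0; apply: measurable_fun_integral_kernel => //.
by move=> B mB; exact: measurable_kernel.
Qed.

Lemma semigroup_ge0 t (h : borel E -> \bar R) x : (forall x, 0 <= h x) ->
  0 <= semigroup X P t h x.
Proof. by move=> h0; apply: integral_ge0 => w _. Qed.

Lemma measurable_semigroup t (h : borel E -> \bar R) : (0 <= t)%R ->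
  measurable_fun [set: borel E] h -> (forall x, 0 <= h x) ->
  measurable_fun [set: borel E] (semigroup X P t h).
Proof.
move=> t0 mh h0; apply: measurable_expectation => //.
exact: measurableT_comp mh (measurable_process t0).
Qed.

Lemma integral_weight_indicator (mu : {measure set Omega -> \bar R}) (A : set Omega)
    (f : Omega -> \bar R) : measurable A ->
  \int[mu]_w (f w * indicator A w) = \int[mu]_(w in A) f w.
Proof.
move=> mA; rewrite [RHS]integral_mkcond; apply: eq_integral => w _.
rewrite /indicator patchE indicE; case: ifP => _; first by rewrite mule1.
by rewrite mule0.
Qed.

(** The Markov property is assumed for events; both sides are positive functionals
    of [h]. *)
Lemma markov_step x s t A (h : borel E -> \bar R) : (0 <= s)%R -> (0 <= t)%R ->
  natural_filtration X t A -> measurable_fun [set: borel E] h -> (forall x, 0 <= h x) ->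
  \int[P x]_w (h (X (s + t)%R w) * indicator A w) =
  \int[P x]_w (semigroup X P s h (X t w) * indicator A w).
Proof.
move=> s0 t0 hA mh h0.
have mA := natural_filtration_measurable hA.
have mXs := measurable_process s0; have mXt := measurable_process t0.
have mXst := measurable_process (addr_ge0 s0 t0).
have L1 := weighted_integral_functional (P x) mXst (measurable_indicator mA) (indicator_ge0 A).
have L2 := iterated_integral_functional (P x) P mXt mXs (measurable_indicator mA)
  (indicator_ge0 A).
apply: (pf_eq_on_measurable_sets L1 L2 _ mh h0) => B mB.
rewrite !integral_weight_indicator//.
have mXB : measurable (X s @^-1` B) by rewrite -[X in measurable X]setTI; exact: mXs.
have mXB' : measurable (X (s + t)%R @^-1` B).
  by rewrite -[X in measurable X]setTI; exact: mXst.
rewrite /= (_ : (fun w => indicator B (X (s + t)%R w)) = indicator (X (s + t)%R @^-1` B))//.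
rewrite integral_indic// setIC (brp_markov hX)//.
apply: eq_integral => w _.
rewrite (_ : (fun w => indicator B (X s w)) = indicator (X s @^-1` B))//.
by rewrite integral_indic// setIT.
Qed.

Lemma one_eq_addl (y : \bar R) : 1 = 1 + y -> y = 0.
Proof. by case: y => [r| |]//= [e]; congr EFin; lra. Qed.

(** Under [P^x] the process starts at [x] almost surely. *)
Lemma integral_initial x (h : borel E -> \bar R) (k : Omega -> \bar R) :
  measurable_fun [set: borel E] h -> (forall x, 0 <= h x) ->
  measurable_fun [set: Omega] k -> (forall x, 0 <= k x) ->
  \int[P x]_w (k w * h (X 0%R w)) = (\int[P x]_w k w) * h x.
Proof.
move=> mh h0 mk k0; have mX0 := measurable_process (lexx 0%R).
transitivity (\int[P x]_w (k w * h x)).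
  apply: ge0_ae_eq_integral => //.
  - by apply: emeasurable_funM => //; exact: measurableT_comp mh mX0.
  - exact: emeasurable_funM.
  - by move=> w _; exact: mule_ge0.
  - by move=> w _; exact: mule_ge0.
  have mS : measurable (X 0%R @^-1` [set x]).
    by rewrite -[X in measurable X]setTI; apply: mX0 => //; exact: borel_set1.
  exists (~` (X 0%R @^-1` [set x])); split.
  - exact: measurableC.
  - have := @measureU _ _ _ (P x) _ _ mS (measurableC mS) (setICr _).
    have PS : P x (X 0%R @^-1` [set x] : set Omega) = 1 := brp_initial hX x.
    have PT : P x [set: Omega] = 1 by exact: prob_kernel.
    rewrite setUv [X in _ = X + _](PS : _ = 1) [X in X = _](PT : _ = 1).
    by move/one_eq_addl.
  - by move=> w /= hw hx; apply: hw => _; rewrite hx.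
by rewrite ge0_integralZr.
Qed.

(** For increasing times this is [p_{s1 - t} (1_{B s1} p_{s2 - s1} (1_{B s2} ...))],
    the probability that a path started at time [t] is in [B s] at each [s] of the
    list. *)
Fixpoint chain (B : R -> set (borel E)) (t : R) (ts : seq R) : borel E -> \bar R :=
  if ts is s :: ts' then
    semigroup X P (s - t) (fun y => indicator (B s) y * chain B s ts' y)
  else fun=> 1.

Lemma chain_ge0 B t ts x : 0 <= chain B t ts x.
Proof.
elim: ts t x => [|s ts IH] t x //=; apply: semigroup_ge0 => y.
by apply: mule_ge0 => //; exact: indicator_ge0.
Qed.

Lemma measurable_chain (B : R -> set (borel E)) t ts :
  (forall s, measurable (B s)) -> path <=%R t ts ->
  measurable_fun [set: borel E] (chain B t ts).
Proof.
move=> mB; elim: ts t => [|s ts IH] t //= /andP[ts_ pts].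
apply: measurable_semigroup; first by rewrite subr_ge0.
  by apply: emeasurable_funM; [exact: measurable_indicator|exact: IH].
by move=> y; apply: mule_ge0; [exact: indicator_ge0|exact: chain_ge0].
Qed.

Lemma indicatorI (T : Type) (A B : set T) x :
  ((\1_(A `&` B) x)%:E = (\1_A x)%:E * (\1_B x)%:E :> \bar R).
Proof. by rewrite indicI/= EFinM. Qed.

(** By induction: the event at the earliest time is absorbed into the past [A], and
    one Markov step goes back from that time to [t + t0]. *)
Lemma chain_forward x (B : R -> set (borel E)) t t0 ts A : (forall s, measurable (B s)) ->
  (0 <= t)%R -> (0 <= t0)%R -> path <=%R t0 ts -> natural_filtration X (t + t0) A ->
  P x (A `&` [set w | forall s, s \in ts -> B s (X (t + s)%R w)]) =
  \int[P x]_w (chain B t0 ts (X (t + t0)%R w) * indicator A w).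
Proof.
move=> mB tge0; elim: ts t0 A => [|s ts IH] t0 A t00 /=.
  move=> _ hA; rewrite (_ : [set _ | _] = setT) ?setIT; last exact/seteqP.
  rewrite integral_weight_indicator ?integral_cst ?mul1e//.
  - exact: natural_filtration_measurable hA.
  - exact: natural_filtration_measurable hA.
move=> /andP[t0s pts] hA.
have s0 : (0 <= s)%R := le_trans t00 t0s.
rewrite (_ : A `&` _ = (A `&` (X (t + s)%R @^-1` B s)) `&`
    [set w | forall u, u \in ts -> B u (X (t + u)%R w)]); last first.
  apply/seteqP; split => w /=.
    move=> [Aw H]; split.
      by split => //; apply: H; rewrite mem_head.
    by move=> u uts; apply: H; rewrite in_cons uts orbT.
  move=> [[Aw H1] H2]; split => // u.
  by rewrite in_cons => /orP[/eqP ->//|]; exact: H2.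
rewrite (IH s)//; last first.
  apply: natural_filtrationI.
    by apply: natural_filtration_le hA; rewrite lerD2l.
  by apply: natural_filtration_coord => //; rewrite lexx addr_ge0.
have -> : (t + s = (s - t0) + (t + t0))%R by rewrite addrCA subrK.
rewrite -markov_step//.
- apply: eq_integral => w _; rewrite {1}/indicator indicatorI.
  rewrite muleA muleAC; congr (_ * _); rewrite muleC; congr (_ * _).
- by rewrite subr_ge0.
- exact: addr_ge0.
- apply: emeasurable_funM; first exact: measurable_indicator.
  exact: measurable_chain.
- by move=> y; apply: mule_ge0; [exact: indicator_ge0|exact: chain_ge0].
Qed.

End process_law.

(** * The Markov property and time reversal on path space *)

Section path_law.
Context (R : realType) (E : ptopologicalType).
Hypothesis hE : lusin_space R E.
Context (d : measure_display) (Omega : measurableType d)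
  (X : R -> Omega -> E) (theta : R -> Omega -> Omega)
  (P : R.-pker (borel E) ~> Omega).
Hypothesis hX : conservative_borel_right_process X theta P.
Hypothesis hcont : continuous_paths X.

Local Notation xi := (sample_path hcont).

Definition path_expectation (Phi : paths R E -> \bar R) (x : borel E) : \bar R :=
  \int[P x]_w Phi (xi w).

Lemma path_expectation_ge0 Phi x : (forall c, 0 <= Phi c) ->
  0 <= path_expectation Phi x.
Proof. by move=> Phi0; exact: integral_ge0. Qed.

Lemma measurable_on_sample_path (Phi : paths R E -> \bar R) :
  measurable_fun [set: paths R E] Phi -> measurable_fun [set: Omega] (Phi \o xi).
Proof. by move=> mPhi; exact: measurableT_comp mPhi (measurable_sample_path hX hcont). Qed.

Lemma measurable_path_expectation (Phi : paths R E -> \bar R) :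
  measurable_fun [set: paths R E] Phi -> (forall c, 0 <= Phi c) ->
  measurable_fun [set: borel E] (path_expectation Phi).
Proof.
by move=> mPhi Phi0; apply: measurable_expectation => //; exact: measurable_on_sample_path.
Qed.

Lemma chain_initial x (B : R -> set (borel E)) ts : (forall s, measurable (B s)) ->
  path <=%R 0%R ts ->
  P x [set w | forall s, s \in ts -> B s (X s w)] = chain X P B 0%R ts x.
Proof.
move=> mB pts.
have := chain_forward hX x mB (lexx 0%R) (lexx 0%R) pts (@natural_filtrationT R E _ _ X _).
rewrite setTI (_ : [set w | _] = [set w | forall s, s \in ts -> B s (X s w)]); last first.
  by apply/seteqP; split => w /= H s sts; have := H s sts; rewrite add0r.
move=> ->; rewrite addr0.
have := @integral_initial _ _ hE _ _ _ _ _ hX x (chain X P B 0%R ts) (cst 1)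
  (measurable_chain hX mB pts) (fun y => chain_ge0 _ _ _ _ _ y) (measurable_cst _)
  (fun=> lee01).
rewrite integral_cst// mul1e (_ : P x _ = 1); last exact: prob_kernel.
rewrite mul1e => <-; apply: eq_integral => w _.
by rewrite /indicator indicT mul1e mule1.
Qed.

Lemma finite_cylinder_sorted ts (B : R -> set (borel E)) :
  finite_cylinder (sort <=%R ts) B = finite_cylinder ts B.
Proof.
by apply/seteqP; split => c /= H s sts; apply: H; rewrite mem_sort in sts *.
Qed.

Lemma path_sort ts : (forall s, s \in ts -> (0 <= s)%R) ->
  path <=%R (0 : R)%R (sort <=%R ts).
Proof.
move=> ts0; rewrite (path_sortedE le_trans) sort_sorted; last exact: le_total.
by rewrite andbT; apply/allP => s; rewrite mem_sort => /ts0.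
Qed.

(** On a cylinder both sides are integrals of the same chain. *)
Lemma markov_paths x t A (Phi : paths R E -> \bar R) : (0 <= t)%R ->
  natural_filtration X t A ->
  measurable_fun [set: paths R E] Phi -> (forall c, 0 <= Phi c) ->
  \int[P x]_w (Phi (shift_path t (xi w)) * indicator A w) =
  \int[P x]_w (path_expectation Phi (X t w) * indicator A w).
Proof.
move=> t0 hA mPhi Phi0.
have mA := natural_filtration_measurable hX hA.
have mxi := measurable_sample_path hX hcont.
have mshift : measurable_fun [set: Omega] (fun w => shift_path t (xi w)).
  exact: measurableT_comp (measurable_shift_path t0) mxi.
have L1 := weighted_integral_functional (P x) mshift (measurable_indicator mA) (indicator_ge0 A).
have L2 := iterated_integral_functional (P x) P (measurable_process hX t0) mxi
  (measurable_indicator mA) (indicator_ge0 A).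
apply: (pf_eq_on_pi_system (g := fun=> setT) L1 L2 (@measurable_finite_cylindersE R E)
    (@setI_closed_finite_cylinders R E) _ _ _ _ mPhi Phi0).
- move=> _; exists [::], (fun=> setT); split => //; exact/esym/seteqP.
- by rewrite bigcup_const.
- move=> _ [ts [B [ts0 mB ->]]].
  rewrite -finite_cylinder_sorted; have pts := path_sort ts0.
  have {}ts0 s : s \in sort <=%R ts -> (0 <= s)%R by rewrite mem_sort; exact: ts0.
  move: (sort _ _) ts0 pts => us us0 pus.
  have mC u : (0 <= u)%R ->
      measurable [set w | forall s, s \in us -> B s (X (u + s)%R w)].
    move=> u0; apply: (@measurable_finite_forall _ us _ Omega
      (fun s => [set w | B s (X (u + s)%R w)])) => s /us0 s0.
    by rewrite -[X in measurable X]setTI; apply: (measurable_process hX); rewrite ?addr_ge0.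
  rewrite (eq_integral (indicator
      (A `&` [set w | forall s, s \in us -> B s (X (t + s)%R w)]))); last first.
    move=> w _; rewrite /indicator indicatorI muleC; congr (_ * _).
    rewrite !indicE; congr (_%:R)%:E; congr (nat_of_bool _).
    apply/idP/idP => /set_mem H; apply/mem_set => s sus.
      by have := H s sus; rewrite coord_shift coord_sample_path// addr_ge0// us0.
    by rewrite coord_shift coord_sample_path; [exact: H|rewrite addr_ge0// us0].
  rewrite integral_indic//; last by apply: measurableI => //; exact: mC.
  rewrite setIT (chain_forward hX x mB t0 (lexx 0%R) pus); last by rewrite addr0.
  rewrite addr0; apply: eq_integral => w _; congr (_ * _).
  rewrite -(chain_initial _ mB pus).
  rewrite (eq_integral (indicator [set w | forall s, s \in us -> B s (X s w)])); last first.
    move=> v _; rewrite /indicator !indicE; congr (_%:R)%:E; congr (nat_of_bool _).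
    apply/idP/idP => /set_mem H; apply/mem_set => s sus.
      by have := H s sus; rewrite coord_sample_path// us0.
    by rewrite coord_sample_path; [exact: H|rewrite us0].
  rewrite integral_indic ?setIT//.
  have := mC 0%R (lexx _); congr measurable.
  by apply/seteqP; split => v /= H s sus; have := H s sus; rewrite add0r.
- move=> _; rewrite integral_weight_indicator// (eq_integral (cst 1)).
    rewrite integral_cst// mul1e; apply: (@le_lt_trans _ _ (P x setT)).
      by apply: le_measure => //; rewrite inE.
    by rewrite (_ : P x _ = 1) ?ltry//; exact: prob_kernel.
  by move=> w _; rewrite /indicator indicT.
Qed.

Variable m : {sigma_finite_measure set (borel E) -> \bar R}.
Hypothesis hsym : symmetric_process X P m.

Lemma iterated_functional :
  positive_functional (fun f : Omega -> \bar R => \int[m]_x \int[P x]_w f w).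
Proof.
have := @iterated_integral_functional R _ _ _ _ Omega (borel E) (borel E) Omega m P
  id id (cst 1) (@measurable_id _ _ _) (@measurable_id _ _ _) (measurable_cst 1) (fun=> lee01).
congr positive_functional; apply/funext => f; apply: eq_integral => x _.
by rewrite /= mule1.
Qed.

(** The law [P^m], an infinite measure in general. *)
Definition initial_m : {measure set Omega -> \bar R} :=
  measure_of_functional iterated_functional.

Lemma integral_initial_m (f : Omega -> \bar R) : measurable_fun [set: Omega] f ->
  (forall w, 0 <= f w) ->
  \int[initial_m]_w f w = \int[m]_x \int[P x]_w f w.
Proof.
move=> mf f0.
have L : positive_functional (fun f : Omega -> \bar R => \int[initial_m]_w f w).
  have := @weighted_integral_functional R _ _ Omega Omega initial_m id (cst 1)
    (@measurable_id _ _ _) (measurable_cst 1) (fun=> lee01).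
  congr positive_functional; apply/funext => h; apply: eq_integral => x _.
  by rewrite /= mule1.
apply: (pf_eq_on_measurable_sets L iterated_functional) => // A mA.
by rewrite integral_indic// setIT.
Qed.

Lemma markov_initial_m t A (Phi : paths R E -> \bar R) : (0 <= t)%R ->
  natural_filtration X t A ->
  measurable_fun [set: paths R E] Phi -> (forall c, 0 <= Phi c) ->
  \int[initial_m]_w (Phi (shift_path t (xi w)) * indicator A w) =
  \int[initial_m]_w (path_expectation Phi (X t w) * indicator A w).
Proof.
move=> t0 hA mPhi Phi0.
have mA := natural_filtration_measurable hX hA.
have mxi := measurable_sample_path hX hcont.
rewrite !integral_initial_m//.
- by apply: eq_integral => x _; exact: markov_paths.
- apply: emeasurable_funM; last exact: measurable_indicator.
  apply: measurableT_comp (measurable_process hX t0).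
  exact: measurable_path_expectation.
- move=> w; apply: mule_ge0; last exact: indicator_ge0.
  exact: path_expectation_ge0.
- apply: emeasurable_funM; last exact: measurable_indicator.
  by apply: (measurableT_comp mPhi); exact: measurableT_comp (measurable_shift_path t0) mxi.
- by move=> w; apply: mule_ge0 => //; exact: indicator_ge0.
Qed.

Lemma markov_step_initial_m s t A (h : borel E -> \bar R) : (0 <= s)%R -> (0 <= t)%R ->
  natural_filtration X t A -> measurable_fun [set: borel E] h -> (forall x, 0 <= h x) ->
  \int[initial_m]_w (h (X (s + t)%R w) * indicator A w) =
  \int[initial_m]_w (semigroup X P s h (X t w) * indicator A w).
Proof.
move=> s0 t0 hA mh h0.
have mA := natural_filtration_measurable hX hA.
rewrite !integral_initial_m//.
- by apply: eq_integral => x _; exact: (markov_step hX).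
- apply: emeasurable_funM; last exact: measurable_indicator.
  apply: measurableT_comp (measurable_process hX t0).
  exact: (measurable_semigroup hX s0 mh h0).
- move=> w; apply: mule_ge0; last exact: indicator_ge0.
  exact: semigroup_ge0.
- apply: emeasurable_funM; last exact: measurable_indicator.
  by apply: (measurableT_comp mh); apply: (measurable_process hX); exact: addr_ge0.
- by move=> w; apply: mule_ge0 => //; exact: indicator_ge0.
Qed.

Lemma semigroup_cst1 t x : semigroup X P t (fun=> 1) x = 1.
Proof.
rewrite /semigroup integral_cst// mul1e; exact: prob_kernel.
Qed.

(** Symmetry against the constant [1], which [p_t] preserves, shows that [m] is
    invariant. *)
Lemma stationary_marginal t (h : borel E -> \bar R) : (0 <= t)%R ->
  measurable_fun [set: borel E] h -> (forall x, 0 <= h x) ->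
  \int[initial_m]_w h (X t w) = \int[m]_x h x.
Proof.
move=> t0 mh h0; rewrite integral_initial_m//; last first.
  exact: measurableT_comp mh (measurable_process hX t0).
have := hsym t0 mh (measurable_cst (1 : \bar R)) h0 (fun=> lee01).
under eq_integral do rewrite mule1.
move=> ->; apply: eq_integral => x _.
by rewrite semigroup_cst1 mule1.
Qed.

Lemma stationary_paths t (Phi : paths R E -> \bar R) : (0 <= t)%R ->
  measurable_fun [set: paths R E] Phi -> (forall c, 0 <= Phi c) ->
  \int[initial_m]_w Phi (shift_path t (xi w)) = \int[m]_x path_expectation Phi x.
Proof.
move=> t0 mPhi Phi0.
rewrite -(stationary_marginal t0); last 2 first.
- exact: measurable_path_expectation.
- by move=> x; exact: path_expectation_ge0.
have := markov_initial_m t0 (@natural_filtrationT R E _ _ X t) mPhi Phi0.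
rewrite (eq_integral (fun w => Phi (shift_path t (xi w)))); last first.
  by move=> w _; rewrite /indicator indicT mule1.
move=> ->; apply: eq_integral => w _; by rewrite /indicator indicT mule1.
Qed.

(** Symmetry of the semigroup, used once for each time, passes the factors from one
    side of the integral against [m] to the other; the chain run backwards from
    [delta] becomes the chain run forwards from [t0]. *)
Lemma chain_backward (B : R -> set (borel E)) (delta : R) ts t0 (v : borel E -> \bar R) :
  (forall s, measurable (B s)) -> (0 <= t0 <= delta)%R -> path <=%R t0 ts ->
  (forall s, s \in ts -> (s <= delta)%R) ->
  measurable_fun [set: borel E] v -> (forall x, 0 <= v x) ->
  \int[initial_m]_w (v (X (delta - t0)%R w) *
    indicator [set w | forall s, s \in ts -> B s (X (delta - s)%R w)] w) =
  \int[m]_x (v x * chain X P B t0 ts x).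
Proof.
move=> mB; elim: ts t0 v => [|s ts IH] t0 v /andP[t00 t0d].
  move=> _ _ mv v0.
  rewrite (eq_integral (fun w => v (X (delta - t0)%R w))); last first.
    by move=> w _; rewrite /indicator indicE mem_set// mule1.
  apply: (etrans (@stationary_marginal (delta - t0)%R v _ mv v0)); first by rewrite subr_ge0.
  by apply: eq_integral => x _; rewrite mule1.
move=> /andP[t0s pts] tsd mv v0.
have sd : (s <= delta)%R by apply: tsd; rewrite mem_head.
have s0 : (0 <= s)%R := le_trans t00 t0s.
have {}tsd u : u \in ts -> (u <= delta)%R.
  by move=> uts; apply: tsd; rewrite in_cons uts orbT.
have {}pts : path <=%R s ts := pts.
have st u : u \in ts -> (s <= u)%R.
  by move: pts; rewrite (path_sortedE le_trans) => /andP[/allP H _] /H.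
rewrite (_ : chain X P B t0 (s :: ts) =
  semigroup X P (s - t0) (fun y => indicator (B s) y * chain X P B s ts y))//.
set rest := [set w | forall u, u \in ts -> B u (X (delta - u)%R w)].
have -> : [set w | forall u, u \in s :: ts -> B u (X (delta - u)%R w)] =
    X (delta - s)%R @^-1` B s `&` rest.
  apply/seteqP; split => w /=.
    move=> H; split; first by apply: H; rewrite mem_head.
    by move=> u uts; apply: H; rewrite in_cons uts orbT.
  move=> [H1 H2] u.
  by rewrite in_cons => /orP[/eqP ->//|]; exact: H2.
have hrest : natural_filtration X (delta - s)%R rest.
  pose T := g_sigma_algebraType [set A | exists u (B : set (borel E)),
        [/\ (0 <= u <= delta - s)%R, measurable B & A = X u @^-1` B]].
  apply: (@measurable_finite_forall _ ts _ T (fun u => X (delta - u)%R @^-1` B u)).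
  move=> u uts; apply: natural_filtration_coord; last exact: mB.
  by rewrite subr_ge0 tsd//= lerD2l lerN2 st.
have -> : (delta - t0 = (s - t0) + (delta - s))%R by lra.
rewrite (@markov_step_initial_m (s - t0)%R (delta - s)%R _ v) ?subr_ge0//; last first.
- apply: natural_filtrationI => //.
  by apply: natural_filtration_coord => //; rewrite lexx subr_ge0 sd.
pose v' y := indicator (B s) y * semigroup X P (s - t0) v y.
transitivity (\int[initial_m]_w (v' (X (delta - s)%R w) * indicator rest w)).
  apply: eq_integral => w _; rewrite {1}/indicator indicatorI muleA; congr (_ * _).
  by rewrite muleC.
have mv' : measurable_fun [set: borel E] v'.
  apply: emeasurable_funM; first exact: measurable_indicator.
  by apply: (measurable_semigroup hX) => //; rewrite subr_ge0.
have v'0 x : 0 <= v' x.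
  by apply: mule_ge0; [exact: indicator_ge0|exact: semigroup_ge0].
rewrite IH//; last by rewrite s0 sd.
have := hsym _ mv (_ : measurable_fun _ (fun y => indicator (B s) y * chain X P B s ts y)) v0.
move=> <-.
- by apply: eq_integral => x _; rewrite /v' [X in X * _]muleC -muleA.
- by rewrite subr_ge0.
- apply: emeasurable_funM; first exact: measurable_indicator.
  exact: (measurable_chain hX mB pts).
- by move=> x; apply: mule_ge0; [exact: indicator_ge0|exact: chain_ge0].
Qed.

(** On cylinders this is [chain_backward] with [v = 1].  The exhaustion by sets of
    finite measure comes from that of [m], through the position at time [delta]. *)
Lemma reversal_invariance (delta : R) (Phi : paths R E -> \bar R) : (0 <= delta)%R ->
  measurable_fun [set: paths R E] Phi -> (forall c, 0 <= Phi c) ->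
  \int[initial_m]_w Phi (reverse_path delta (xi w)) =
  \int[initial_m]_w Phi (stop_path delta (xi w)).
Proof.
move=> d0 mPhi Phi0.
have mxi := measurable_sample_path hX hcont.
have mrev : measurable_fun [set: Omega] (fun w => reverse_path delta (xi w)).
  exact: measurableT_comp (measurable_reverse_path _) mxi.
have mstop : measurable_fun [set: Omega] (fun w => stop_path delta (xi w)).
  exact: measurableT_comp (measurable_stop_path d0) mxi.
have L1 := weighted_integral_functional initial_m mrev (measurable_cst 1) (fun=> lee01).
have L2 := weighted_integral_functional initial_m mstop (measurable_cst 1) (fun=> lee01).
have [Em [EmT Emfin]] : exists G : (set (borel E))^nat, \bigcup_n G n = setT /\
    forall n, measurable (G n) /\ m (G n) < +oo.
  have [G GT Gfin] := sigma_finiteT m.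
  by exists G.
transitivity (\int[initial_m]_w (Phi (reverse_path delta (xi w)) * 1)).
  by apply: eq_integral => w _; rewrite mule1.
transitivity (\int[initial_m]_w (Phi (stop_path delta (xi w)) * 1)); last first.
  by apply: eq_integral => w _; rewrite mule1.
have rev_coord s w : (0 <= s)%R ->
    coord s (reverse_path delta (xi w)) = X (delta - Order.min s delta)%R w.
  move=> s0; rewrite coord_reverse.
  have -> : Order.max 0%R (delta - s)%R = (delta - Order.min s delta)%R.
    by have [sd|sd] := leP s delta; [rewrite max_r ?subr_ge0|rewrite subrr max_l// subr_le0 ltW].
  by rewrite coord_sample_path// subr_ge0 ge_min lexx orbT.
have stop_coord s w : (0 <= s)%R ->
    coord s (stop_path delta (xi w)) = X (Order.min s delta) w.
  by move=> s0; rewrite coord_stop coord_sample_path// le_min s0.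
apply: (pf_eq_on_pi_system (g := fun n => finite_cylinder [:: 0%R] (fun=> Em n)) L1 L2
    (@measurable_finite_cylindersE R E) (@setI_closed_finite_cylinders R E)
    _ _ _ _ mPhi Phi0).
- move=> n; exists [:: 0%R], (fun=> Em n); split => //.
    by move=> s; rewrite inE => /eqP ->.
  by move=> _; have [] := Emfin n.
- apply/seteqP; split => // c _.
  have : [set: borel E] (coord 0%R c) by [].
  rewrite -EmT => -[n _ Emn]; exists n => // s.
  by rewrite inE => /eqP ->.
- move=> _ [ts [B [ts0 mB ->]]].
  (* All times beyond [delta] are stopped at [delta], where their conditions
     accumulate. *)
  pose B' u : set (borel E) :=
    [set x | forall s, s \in ts -> Order.min s delta = u -> B s x].
  pose us := sort <=%R (map (Order.min^~ delta) ts).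
  have mB' u : measurable (B' u).
    apply: (@measurable_finite_forall _ ts _ (borel E)
      (fun s => [set x | Order.min s delta = u -> B s x])) => s _.
    have [->|su] := pselect (Order.min s delta = u).
      rewrite (_ : [set _ | _] = B s)//.
      by apply/seteqP; split => x /=; [exact|move=> Bx _].
    rewrite (_ : [set _ | _] = setT)//.
    by apply/seteqP; split => x //= _ /su.
  have pus : path <=%R 0%R us.
    by apply: path_sort => _ /mapP[s /ts0 s0 ->]; rewrite le_min s0.
  have usd s : s \in us -> (s <= delta)%R.
    by rewrite mem_sort => /mapP[u _ ->]; rewrite ge_min lexx orbT.
  have usE (Y : R -> E) : (forall s, s \in us -> B' s (Y s)) <->
      (forall s, s \in ts -> B s (Y (Order.min s delta))).
    split=> [H s sts|H u].
      by apply: (H (Order.min s delta)) => //; rewrite mem_sort; apply: map_f.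
    by rewrite mem_sort => /mapP[s sts ->] r rts <-; exact: H.
  have cylE (Y : Omega -> paths R E) (Z : R -> Omega -> E) w :
      (forall s, (0 <= s)%R -> coord s (Y w) = Z (Order.min s delta) w) ->
      indicator (finite_cylinder ts B) (Y w) =
      indicator [set w | forall s, s \in us -> B' s (Z s w)] w :> \bar R.
    move=> YZ; rewrite /indicator !indicE; congr (_%:R)%:E; congr (nat_of_bool _).
    apply/idP/idP => /set_mem H; apply/mem_set.
      by apply: (usE (fun s => Z s w)).2 => s sts; rewrite -YZ ?ts0//; exact: H.
    by move=> s sts; rewrite YZ ?ts0//; exact: ((usE (fun s => Z s w)).1 H s sts).
  transitivity (\int[initial_m]_w (cst 1 (X (delta - 0)%R w) *
      indicator [set w | forall s, s \in us -> B' s (X (delta - s)%R w)] w)).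
    apply: eq_integral => w _; rewrite mule1 mul1e.
    by apply: (cylE (fun w => reverse_path delta (xi w)) (fun s => X (delta - s)%R))
      => s s0; exact: rev_coord.
  rewrite chain_backward//; last by rewrite lexx d0.
  transitivity (\int[initial_m]_w
      indicator [set w | forall s, s \in us -> B' s (X s w)] w); last first.
    apply: eq_integral => w _; rewrite mule1; apply/esym.
    by apply: (cylE (fun w => stop_path delta (xi w)) X) => s s0; exact: stop_coord.
  have mcyl : measurable [set w | forall s, s \in us -> B' s (X s w)].
    apply: (@measurable_finite_forall _ us _ Omega (fun s => X s @^-1` B' s)) => s sus.
    rewrite -[X in measurable X]setTI; apply: (measurable_process hX) => //.
    by move: pus; rewrite (path_sortedE le_trans) => /andP[/allP H _]; exact: H.
  rewrite integral_initial_m; last 2 first.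
  + exact: measurable_indicator.
  + by move=> w; exact: indicator_ge0.
  apply: eq_integral => x _; rewrite mul1e integral_indic// setIT.
  by rewrite chain_initial.
- move=> n; have [mEn Enoo] := Emfin n.
  rewrite (eq_integral (fun w => indicator (Em n) (X delta w))); last first.
    move=> w _; rewrite mule1 /indicator !indicE; congr (_%:R)%:E; congr (nat_of_bool _).
    have e : coord 0%R (reverse_path delta (xi w)) = X delta w.
      by rewrite rev_coord// min_l// subr0.
    apply/idP/idP => /set_mem H; apply/mem_set.
      by rewrite -e; apply: H; rewrite mem_head.
    by move=> s; rewrite inE => /eqP ->; rewrite e.
  rewrite (@stationary_marginal delta (indicator (Em n)))//.
  - by rewrite integral_indic// setIT.
  - exact: measurable_indicator.
  - by move=> x; exact: indicator_ge0.
Qed.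

(** Given [X_delta], the reversed past and the future are independent and each has
    the law of the process started afresh.  The Markov property splits off the
    future; reversal then turns the past into a path started from [m]. *)
Lemma reversed_past_and_future (delta : R) (Phi Psi : paths R E -> \bar R) :
  (0 <= delta)%R ->
  measurable_fun [set: paths R E] Phi -> (forall c, 0 <= Phi c) ->
  measurable_fun [set: paths R E] Psi -> (forall c, 0 <= Psi c) ->
  \int[initial_m]_w (Phi (reverse_path delta (xi w)) * Psi (shift_path delta (xi w))) =
  \int[m]_x (path_expectation (Phi \o stop_path delta) x * path_expectation Psi x).
Proof.
move=> d0 mPhi Phi0 mPsi Psi0.
have mxi := measurable_sample_path hX hcont.
have mrev : measurable_fun [set: Omega] (fun w => reverse_path delta (xi w)).
  exact: measurableT_comp (measurable_reverse_path _) mxi.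
have mshift : measurable_fun [set: Omega] (fun w => Psi (shift_path delta (xi w))).
  by apply: (measurableT_comp mPsi); exact: measurableT_comp (measurable_shift_path d0) mxi.
have mE := measurable_path_expectation mPsi Psi0.
have E0 x : 0 <= path_expectation Psi x by exact: path_expectation_ge0.
have mEX : measurable_fun [set: Omega] (fun w => path_expectation Psi (X delta w)).
  exact: measurableT_comp mE (measurable_process hX d0).
have L1 := weighted_integral_functional initial_m mrev mshift (fun w => Psi0 _).
have L2 := weighted_integral_functional initial_m mrev mEX (fun w => E0 _).
transitivity (\int[initial_m]_w (Phi (reverse_path delta (xi w)) *
    path_expectation Psi (X delta w))).
  apply: (pf_eq_on_measurable_sets L1 L2 _ mPhi Phi0) => A mA.
  have hA : natural_filtration X delta [set w | A (reverse_path delta (xi w))].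
    apply: (@preimage_paths _ _ _ (natural_filtration X delta)
      (fun w => reverse_path delta (xi w))) => //.
      exact: natural_filtration_sigma_algebra.
    move=> s B s0 mB.
    rewrite (_ : (fun w => _) = X (Order.max 0%R (delta - s)%R)); last first.
      by apply/funext => w; rewrite coord_reverse coord_sample_path// le_max lexx.
    by apply: natural_filtration_coord => //; rewrite le_max lexx/= ge_max d0 gerBl.
  transitivity (\int[initial_m]_w (Psi (shift_path delta (xi w)) *
      indicator [set w | A (reverse_path delta (xi w))] w)).
    by apply: eq_integral => w _; rewrite muleC.
  rewrite (markov_initial_m d0 hA mPsi Psi0).
  by apply: eq_integral => w _; rewrite muleC.
have mPE : measurable_fun [set: paths R E]
    (fun c => Phi c * path_expectation Psi (coord 0%R c)).
  by apply: emeasurable_funM => //; apply: measurableT_comp mE _; exact: measurable_coord.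
transitivity (\int[initial_m]_w (Phi (stop_path delta (xi w)) *
    path_expectation Psi (X 0%R w))).
  have := reversal_invariance d0 mPE (fun c => mule_ge0 (Phi0 c) (E0 _)).
  rewrite (eq_integral (fun w => Phi (reverse_path delta (xi w)) *
      path_expectation Psi (X delta w))).
    move=> ->; apply: eq_integral => w _; congr (_ * path_expectation _ _).
    by rewrite coord_stop min_l// coord_sample_path.
  move=> w _; congr (_ * path_expectation _ _).
  by rewrite coord_reverse subr0 max_r// coord_sample_path.
have mPs : measurable_fun [set: Omega] (fun w => Phi (stop_path delta (xi w))).
  by apply: (measurableT_comp mPhi); exact: measurableT_comp (measurable_stop_path d0) mxi.
rewrite integral_initial_m.
- by apply: eq_integral => x _; rewrite (integral_initial hE hX).
- apply: emeasurable_funM => //; apply: measurableT_comp mE _.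
  exact: (measurable_process hX).
- by move=> w; exact: mule_ge0.
Qed.

End path_law.

(** * Excursions observed on a time grid *)

Lemma le_limn_einf (R : realType) (u : (\bar R)^nat) (a : \bar R) :
  (\forall n \near \oo, a <= u n) -> a <= limn_einf u.
Proof.
move=> [N _ Nu]; rewrite limn_einf_lim; apply: lime_ge; first exact: is_cvg_einfs.
near=> n; apply: le_ereal_inf_tmp => _ /= [k nk <-]; apply: Nu => /=.
by apply: leq_trans nk; near: n; exact: nbhs_infty_ge.
Unshelve. all: by end_near. Qed.

Lemma cvg_le_liminf (R : realType) (u : (\bar R)^nat) (a : \bar R) :
  (forall n, u n <= a) -> a <= limn_einf u -> u n @[n --> \oo] --> a.
Proof.
move=> ua au; have ec := @is_cvg_einfs R u.
have e : limn (einfs u) = a.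
  apply/eqP; rewrite eq_le -{2}limn_einf_lim au andbT.
  apply: lime_le => //; apply: nearW => n; apply: le_trans (ua n).
  by apply: ereal_inf_lbound; exists n => /=.
apply: (@squeeze_cvge _ _ _ _ (einfs u) _ (cst a)); last 2 first.
- by rewrite -[X in _ --> X]e.
- exact: cvg_cst.
by apply: nearW => n; rewrite ua andbT; apply: ereal_inf_lbound; exists n => /=.
Qed.

Lemma cvg_integral_from_below (R : realType) d (T : measurableType d)
    (mu : {measure set T -> \bar R}) (h : (T -> \bar R)^nat) (g : T -> \bar R) :
  (forall n, measurable_fun [set: T] (h n)) -> measurable_fun [set: T] g ->
  (forall n x, 0 <= h n x) -> (forall n x, h n x <= g x) ->
  (forall x, h n x @[n --> \oo] --> g x) ->
  \int[mu]_x h n x @[n --> \oo] --> \int[mu]_x g x.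
Proof.
move=> mh mg h0 hg cvg; apply: cvg_le_liminf.
  by move=> n; apply: ge0_le_integral.
apply: (@le_trans _ _ (\int[mu]_x limn_einf (h ^~ x))).
  rewrite le_eqVlt; apply/orP; left; apply/eqP; apply: eq_integral => x _.
  by have [-> _] := cvg_limn_einf_sup (cvg x).
exact: fatou.
Qed.

Lemma cvg_esum_from_below (R : realType) (I : choiceType) (S : set I)
    (a : (I -> \bar R)^nat) (b : I -> \bar R) :
  (forall n i, 0 <= a n i) -> (forall n i, a n i <= b i) ->
  (forall i, a n i @[n --> \oo] --> b i) ->
  \esum_(i in S) a n i @[n --> \oo] --> \esum_(i in S) b i.
Proof.
move=> a0 ab cvg; apply: cvg_le_liminf.
  by move=> n; apply: le_esum.
have b0 i : 0 <= b i by exact: le_trans (a0 0%N i) (ab 0%N i).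
apply: ge_ereal_sup => _ /= [Y [finY YS] <-].
rewrite fsbig_finite//=.
have c : (\sum_(i <- fset_set Y) a n i) @[n --> \oo] --> \sum_(i <- fset_set Y) b i.
  elim: (finmap.enum_fset _) => [|i s IH].
    rewrite big_nil (_ : (fun n => _) = cst 0); first exact: cvg_cst.
    by apply/funext => n; rewrite big_nil.
  rewrite big_cons (_ : (fun n => _) = (fun n => a n i + \sum_(j <- s) a n j)).
    by apply: cvgeD => //; apply: ge0_adde_def; rewrite inE ?sume_ge0.
  by apply/funext => n; rewrite big_cons.
have [<- _] := cvg_limn_einf_sup c.
rewrite !limn_einf_lim; apply: lee_lim; [exact: is_cvg_einfs|exact: is_cvg_einfs|].
apply: nearW => n; apply: le_ereal_inf_tmp => _ /= [k nk <-].
apply: (@le_trans _ _ (\sum_(i <- fset_set Y) a k i)).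
  by apply: ereal_inf_lbound; exists k.
by apply: esum_ge; exists Y => //; rewrite fsbig_finite.
Qed.

Section excursion_sums.
Context (R : realType) (E : ptopologicalType) (F : set E).
Hypothesis hF : closed F.
Local Notation nh c t := (next_hit (@coord R E) F c t).
Variables (f : E -> \bar R) (Psi : paths R E -> \bar R).
Hypothesis f0 : forall x, 0 <= f x.
Hypothesis Psi0 : forall c, 0 <= Psi c.
Hypothesis hPsi : unaffected_by_prehit_shift F Psi.

Definition excursion_starts (t : R) (c : paths R E) : set R :=
  [set s | [/\ (0 < s)%R, (s < t)%R, F (coord s c) & s%:E < nh c s]].

Definition excursion_sum (t : R) (c : paths R E) : \bar R :=
  \esum_(s in excursion_starts t c) excursion_value f Psi c s.

(** The first cell is left out: it may contain an excursion that starts at time [0],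
    which the interval [(0, t)] does not count. *)
Definition straddling_sum (t delta : R) (c : paths R E) : \bar R :=
  \sum_(1 <= k < Num.truncn (t / delta)%R) straddling_value F f Psi (k%:R * delta)%R delta c.

Let J (delta : R) c (k : nat) :=
  straddling_starts F (k%:R * delta)%R (k%:R * delta + delta)%R c.

Lemma excursion_value_ge0 c s : 0 <= excursion_value f Psi c s.
Proof. exact: mule_ge0. Qed.

Lemma straddling_sumE (t delta : R) c : straddling_sum t delta c =
  \esum_(s in [set: R]) \sum_(1 <= k < Num.truncn (t / delta)%R)
    (if s \in J delta c k then excursion_value f Psi c s else 0).
Proof.
rewrite esum_sum; last by move=> s k _ _; case: ifP => // _; exact: excursion_value_ge0.
apply: eq_bigr => k _; rewrite straddling_value_esum//; last exact: excursion_value_ge0.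
by rewrite esum_mkcond.
Qed.

Lemma straddling_starts_index (delta : R) c k s : (0 < delta)%R ->
  J delta c k s -> k = Num.truncn (s / delta)%R.
Proof.
move=> d0 [h1 h2 _ _]; apply/esym/truncn_def; apply/andP; split.
  by rewrite ler_pdivlMr.
by rewrite ltr_pdivrMr// -natr1 mulrDl mul1r.
Qed.

(** The starting point determines its cell, so no excursion is counted twice. *)
Lemma straddling_sum_le (t delta : R) c : (0 < delta)%R -> (0 < t)%R ->
  straddling_sum t delta c <= excursion_sum t c.
Proof.
move=> d0 t0; rewrite straddling_sumE /excursion_sum [leRHS]esum_mkcond.
apply: le_esum => s _.
have [[k [kM Jk]]|H] := pselect (exists k,
    k \in index_iota 1 (Num.truncn (t / delta)%R) /\ J delta c k s); last first.
  rewrite big_seq big1//; first by case: ifP => // _; exact: excursion_value_ge0.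
  by move=> k kM; case: ifPn => // /set_mem Jk; exfalso; apply: H; exists k.
rewrite (bigD1_seq k) ?iota_uniq//= big1 ?adde0; last first.
  move=> l /negP lk; case: ifPn => // /set_mem Jl; exfalso; apply: lk.
  by rewrite (straddling_starts_index d0 Jk) (straddling_starts_index d0 Jl).
rewrite (mem_set Jk) mem_set//.
have [h1 h2 h3 h4] := Jk.
move: kM; rewrite mem_index_iota => /andP[k1 kM].
have kd : (delta <= k%:R * delta)%R by apply: ler_peMl; [exact: ltW|rewrite ler1n].
split => //; first by apply: lt_le_trans h1; exact: lt_le_trans d0 kd.
  apply: lt_le_trans h2 _.
  have -> : (k%:R * delta + delta = k.+1%:R * delta)%R by rewrite -natr1 mulrDl mul1r.
  by rewrite -ler_pdivlMr// -truncn_ge_nat ?divr_ge0 ?ltW.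
by apply: lt_trans h4; rewrite lte_fin.
Qed.

(** An excursion longer than the step is still running at the next grid time. *)
Lemma excursion_start_captured (t : R) c s : excursion_starts t c s ->
  exists2 e : R, (0 < e)%R & forall delta : R, (0 < delta < e)%R ->
    exists2 k, k \in index_iota 1 (Num.truncn (t / delta)%R) & J delta c k s.
Proof.
move=> [s0 st Fs sn].
(* a finite lower bound for the end of the excursion *)
have [r sr rn] : exists2 r : R, (s < r)%R & r%:E <= nh c s.
  case: (nh c s) sn => [r| |]//; rewrite ?lte_fin; first by exists r.
  by move=> _; exists (s + 1)%R; rewrite ?ltrDl ?leey.
exists (Order.min s (Order.min (t - s) (r - s)))%R.
  by rewrite !lt_min s0 !subr_gt0 st sr.
move=> delta /andP[d0]; rewrite !lt_min => /and3P[ds dts drs].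
pose k := Num.truncn (s / delta)%R.
have /truncn_itv/andP[k1 k2] : (0 <= s / delta)%R by rewrite divr_ge0// ltW.
rewrite -/k in k1 k2.
move: (k1) (k2); rewrite ler_pdivlMr// ltr_pdivrMr// -natr1 mulrDl mul1r => k1' k2'.
exists k.
  rewrite mem_index_iota; apply/andP; split.
    by rewrite /k truncn_gt0 ler_pdivlMr// mul1r ltW.
  rewrite truncn_gt_nat ler_pdivlMr// -natr1 mulrDl mul1r.
  by lra.
split => //.
by apply: lt_le_trans rn; rewrite lte_fin; lra.
Qed.

(** Finitely many excursions are all captured once the step is small enough, and the
    sum over all excursions is the supremum of the finite sums. *)
Lemma excursion_sum_le_liminf (t : R) c (u : R^nat) : (forall n, (0 < u n)%R) ->
  u n @[n --> \oo] --> (0 : R)%R ->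
  excursion_sum t c <= limn_einf (fun n => straddling_sum t (u n) c).
Proof.
move=> u0 ucvg; apply: ge_ereal_sup => _ /= [Y [finY YJ] <-].
rewrite -esum_fset//; last by move=> s _; exact: excursion_value_ge0.
have ev : \forall n \near \oo, \esum_(s in Y) excursion_value f Psi c s <=
    straddling_sum t (u n) c.
  have : \forall n \near \oo, forall s, s \in fset_set Y ->
      exists2 k, k \in index_iota 1 (Num.truncn (t / u n)%R) & J (u n) c k s.
    have : nbhs \oo (\bigcap_(s in [set` fset_set Y]) [set n | exists2 k,
        k \in index_iota 1 (Num.truncn (t / u n)%R) & J (u n) c k s]).
      apply: filter_bigI => s; rewrite in_fset_set// => /set_mem/YJ.
      move=> /excursion_start_captured[e e0 he].
      have /cvgrPdist_lt/(_ e e0) hh := ucvg.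
      apply: (@filterS _ \oo _ _ _ _ hh) => n /=; rewrite sub0r normrN gtr0_norm// => une.
      by apply: he; rewrite u0.
    move=> hh; apply: (@filterS _ \oo _ _ _ _ hh) => n /= H s sY; exact: H.
  move=> hh; apply: (@filterS _ \oo _ _ _ _ hh) => n H; rewrite straddling_sumE [leLHS]esum_mkcond.
  apply: le_esum => s _.
  have s_ge0 k : 0 <= (if s \in J (u n) c k then excursion_value f Psi c s else 0).
    by case: ifP => // _; exact: excursion_value_ge0.
  case: ifPn => [sY|_]; last exact: sume_ge0.
  have [|k kM Jk] := H s; first by rewrite in_fset_set.
  rewrite (bigD1_seq k) ?iota_uniq//= (mem_set Jk) leeDl//.
  exact: sume_ge0.
exact: le_limn_einf.
Qed.

End excursion_sums.

(** * The excursion measure as a sum over left endpoints *)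

Section excursion_measure_sum.
Context (R : realType) (E : ptopologicalType).
Context (d : measure_display) (Omega : measurableType d) (X : R -> Omega -> E).
Hypothesis hcont : continuous_paths X.
Variable F : set E.
Hypothesis hF : closed F.

Local Notation xi := (sample_path hcont).
Local Notation nh c t := (next_hit (@coord R E) F c t).

Lemma next_hit_sample_path w t : (0 <= t)%R -> next_hit X F w t = nh (xi w) t.
Proof.
move=> t0; congr ereal_inf; apply/seteqP; split => _ [s [ts Fs] <-];
  exists s => //; split=> //; move: Fs; rewrite coord_sample_path// ltW//;
  exact: le_lt_trans ts.
Qed.

(** For [u < s] the next hit after [u] lies between [u] and [s]. *)
Lemma next_hit_left_at_hit (c : paths R E) s : F (coord s c) ->
  nh c u @[u --> s^'-] --> s%:E.
Proof.
move=> Fs; apply: (@squeeze_cvge _ _ _ _ (fun u : R => u%:E) _ (cst s%:E)).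
- near=> u; rewrite next_hit_ge/=.
  by apply: next_hit_le => //; near: u; exact: nbhs_left_lt.
- apply: cvg_EFin; first exact: nearW.
  by apply: cvg_at_left_filter; exact: cvg_id.
- exact: cvg_cst.
Unshelve. all: by end_near. Qed.

(** The path avoids [F] near [s], so the next hit is constant just before [s]. *)
Lemma next_hit_left_off_hit (c : paths R E) s : ~ F (coord s c) ->
  nh c u @[u --> s^'-] --> nh c s.
Proof.
move=> nF.
have oF : open (~` F) by exact: closed_openC.
have : nbhs s ((fun s => coord s c) @^-1` (~` F)).
  by apply: coord_continuous; exact: open_nbhs_nbhs.
move=> [e /= e0 he].
apply: cvg_near_cst; near=> u.
have us : (u < s)%R by near: u; exact: nbhs_left_lt.
have ue : (s - e < u)%R by near: u; apply: nbhs_left_gt; rewrite ltrBlDr ltrDl.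
apply/esym/next_hit_const; first exact: ltW.
apply: (@lt_le_trans _ _ (s + e)%:E); first by rewrite lte_fin ltrDl.
apply: le_next_hit => v uv; rewrite lte_fin => vse; apply: he => /=.
by rewrite ltr_norml; apply/andP; split; lra.
Unshelve. all: by end_near. Qed.

Lemma next_hit_left_sample_path w s : (0 < s)%R ->
  next_hit_left X F w s = if `[< F (X s w) >] then s%:E else nh (xi w) s.
Proof.
move=> s0; apply: cvg_lim => //.
have : \forall u \near s^'-, nh (xi w) u = next_hit X F w u.
  near=> u; rewrite next_hit_sample_path//.
  by near: u; apply: nbhs_left_ge.
move=> h; apply: (cvg_trans (near_eq_cvg h)).
rewrite -(coord_sample_path hcont w (ltW s0)).
by case: asboolP; [exact: next_hit_left_at_hit|exact: next_hit_left_off_hit].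
Unshelve. all: by end_near. Qed.

(** For [s > 0] the left limit [R(s-)] is [s] if [X_s] is in [F] and [R(s)] if not;
    so the jumps of [R] are the left endpoints of excursions. *)
Lemma excursion_measureE (G : option E -> option E -> \bar R) (f : E -> \bar R)
    (Psi : paths R E -> \bar R) w t :
  (forall s, F (coord s (xi w)) -> s%:E < nh (xi w) s -> (0 < s)%R ->
    G (Some (X s w)) (extended_process X (nh (xi w) s) w) =
    excursion_value f Psi (xi w) s) ->
  excursion_measure X F G w `]0%R, t[%classic = excursion_sum F f Psi t (xi w).
Proof.
move=> hG; rewrite /excursion_measure /excursion_sum esum_mkcond [RHS]esum_mkcond.
apply: eq_esum => s _; case: ifPn => [/set_mem/=[s0]|].
  rewrite next_hit_left_sample_path// next_hit_sample_path ?ltW//.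
  case: asboolP => [Fs sn|]; last by rewrite ltxx.
  have Fs' : F (coord s (xi w)) by rewrite coord_sample_path ?ltW.
  rewrite diracE; case: ifPn => [/set_mem[_ st _ _]|nJ].
    by rewrite mem_set ?mule1 ?hG//= in_itv/= s0.
  rewrite memNset ?mule0//= in_itv/= s0/= => st.
  by move/negP: nJ; apply; apply: mem_set; split.
move=> /negP nA; case: ifPn => // /set_mem[s0 st Fs sn]; exfalso; apply: nA.
apply: mem_set; split => //.
rewrite next_hit_left_sample_path// next_hit_sample_path ?ltW// asboolT//.
by rewrite -(coord_sample_path hcont w (ltW s0)).
Qed.

End excursion_measure_sum.

(** * The energy form as an expectation *)

Lemma cvg_at_right_seq (R : realType) (T : topologicalType) (h : R -> T) (p : R) (l : T) :
  (forall u : R^nat, (forall n, (p < u n)%R) -> u n @[n --> \oo] --> p ->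
    h (u n) @[n --> \oo] --> l) -> h x @[x --> p^'+] --> l.
Proof.
move=> H U lU; apply: contrapT => nU.
have ex n : exists x : R, (p < x)%R /\ (x < p + n.+1%:R^-1)%R /\ ~ U (h x).
  apply: contrapT => nex; apply: nU.
  suff : \forall x \near p^'+, U (h x) by [].
  near=> x.
  apply: contrapT => nUx; apply: nex; exists x; split.
    by near: x; exact: nbhs_right_gt.
  split => //; near: x; apply: nbhs_right_lt; rewrite ltrDl.
  by rewrite invr_gt0.
have [u hu] := choice ex.
have uc : u n @[n --> \oo] --> p.
  apply/cvgrPdist_lt => e e0; near=> n.
  have [h1 [h2 _]] := hu n.
  rewrite ltr0_norm ?subr_lt0// opprB ltrBlDl.
  apply: (lt_trans h2); rewrite ltrD2l.
  by near: n; exact: near_infty_natSinv_lt (PosNum e0).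
have [N _ HN] := H u (fun n => (hu n).1) uc _ lU.
by have [_ [_]] := hu N; apply; exact: (HN N (leqnn N)).
Unshelve. all: by end_near. Qed.

Section hitting_before.
Context (R : realType) (E : ptopologicalType) (F : set E).
Hypothesis hF : closed F.
Implicit Types (c : paths R E).
Local Notation T c := (hitting_time (@coord R E) F c).

(** The hit can be taken at a positive time even if [T = 0]: then [F] is met at
    arbitrarily small positive times. *)
Lemma hitting_time_le (delta : R) c : (0 < delta)%R ->
  T c <= delta%:E <-> exists s, [/\ (0 < s)%R, (s <= delta)%R & F (coord s c)].
Proof.
move=> d0; split; last first.
  move=> [s [s0 sd Fs]]; apply: (@le_trans _ _ s%:E); last by rewrite lee_fin.
  exact: next_hit_le.
move=> Td; have Toy : T c < +oo by apply: le_lt_trans Td _; rewrite ltry.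
have [r [rE r0 Fr]] := next_hit_fin hF Toy.
have rd : (r <= delta)%R by rewrite -lee_fin -rE.
have [r00|r00] := eqVneq r 0%R; last by exists r; split => //; rewrite lt_neqAle eq_sym r00.
have : T c < delta%:E by rewrite [T c]rE lte_fin r00.
by move=> /next_hit_lt_ex[s [s0 sd Fs]]; exists s; split => //; exact: ltW.
Qed.

Lemma coord_stop_le (delta s : R) c : (s <= delta)%R ->
  coord s (stop_path delta c) = coord s c.
Proof. by move=> sd; rewrite coord_stop min_l. Qed.

Lemma hitting_time_stop_le (delta : R) c : (0 < delta)%R ->
  (T (stop_path delta c) <= delta%:E) = (T c <= delta%:E).
Proof.
move=> d0; apply/idP/idP => /(hitting_time_le _ d0)[s [s0 sd Fs]];
  by apply/(hitting_time_le _ d0); exists s; split => //; rewrite coord_stop_le in Fs *.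
Qed.

Lemma early_hit_value_stop (f : E -> \bar R) (delta : R) c : (0 < delta)%R ->
  early_hit_value F f delta (stop_path delta c) = early_hit_value F f delta c.
Proof.
move=> d0; rewrite /early_hit_value hitting_time_stop_le// coord_stop_le; last exact: ltW.
case: asboolP => // -[nF Td].
have Toy : T c < +oo by apply: le_lt_trans Td _; rewrite ltry.
have [r [rE _ Fr]] := next_hit_fin hF Toy.
have rd : (r <= delta)%R by rewrite -lee_fin -rE.
have r0 : (0 < r)%R by rewrite -lte_fin -rE; exact: hitting_time_gt0.
have Ts : T (stop_path delta c) = r%:E.
  apply/eqP; rewrite eq_le; apply/andP; split.
    by apply: next_hit_le => //; rewrite coord_stop_le.
  apply: le_next_hit => s s0; rewrite lte_fin => sr.
  rewrite coord_stop_le; last by apply: ltW; exact: lt_le_trans rd.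
  by apply: (@lt_next_hit_notin _ _ F c 0%R) => //; rewrite rE lte_fin.
by rewrite /hit_value Ts [T c]rE ltry [fine _]/= coord_stop_le.
Qed.

End hitting_before.

Section energy_identity.
Context (R : realType) (E : ptopologicalType).
Hypothesis hE : lusin_space R E.
Variable m : {sigma_finite_measure set (borel E) -> \bar R}.
Context (d : measure_display) (Omega : measurableType d)
  (X : R -> Omega -> E) (theta : R -> Omega -> Omega)
  (P : R.-pker (borel E) ~> Omega).
Hypothesis hX : conservative_borel_right_process X theta P.
Hypothesis hcont : continuous_paths X.
Hypothesis hsym : symmetric_process X P m.
Variable F : set E.
Hypothesis hF : closed F.

Local Notation xi := (sample_path hcont).
Local Notation T c := (hitting_time (@coord R E) F c).
Local Notation Pm := (initial_m P m).
Local Notation pathE := (path_expectation P hcont).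

Lemma hitting_time_sample_path w : hitting_time X F w = T (xi w).
Proof. exact: next_hit_sample_path. Qed.

(** Whether [T <= delta] can be decided on the path stopped at [delta]. *)
Lemma natural_filtration_unhit (delta : R) : (0 < delta)%R ->
  natural_filtration X delta [set w | delta%:E < T (xi w)].
Proof.
move=> d0.
rewrite (_ : [set w | _] =
    (fun w => stop_path delta (xi w)) @^-1` [set c | delta%:E < T c]); last first.
  by apply/seteqP; split => w /=; rewrite !ltNge hitting_time_stop_le.
apply: preimage_paths.
- exact: natural_filtration_sigma_algebra.
- move=> s B s0 mB.
  rewrite (_ : (fun w => _) = X (Order.min s delta)); last first.
    by apply/funext => w; rewrite coord_stop coord_sample_path// le_min s0 ltW.
  by apply: natural_filtration_coord => //; rewrite le_min s0 ltW//= ge_min lexx orbT.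
have := measurable_hitting_time hE hF measurableT
  (emeasurable_itv `]delta%:E, +oo[).
rewrite setTI; congr measurable; apply/seteqP; split => c /=; rewrite in_itv/= ?andbT//.
Qed.

Variables (f : borel E -> \bar R) (Psi : paths R E -> \bar R).
Hypothesis mf : measurable_fun [set: borel E] f.
Hypothesis f0 : forall x, 0 <= f x.
Hypothesis mPsi : measurable_fun [set: paths R E] Psi.
Hypothesis Psi0 : forall c, 0 <= Psi c.
Hypothesis hPsi : unaffected_by_prehit_shift F Psi.

Let mhv : measurable_fun [set: Omega] (fun w => hit_value F f (xi w)).
Proof. exact: (measurable_on_sample_path hX hcont (measurable_hit_value hE hF mf)). Qed.

Let hv0 c : 0 <= hit_value F f c.
Proof. by rewrite /hit_value; case: ifP. Qed.

(** The Markov property at [delta] gives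
    [E^x(Hf(X_delta); delta < T) = E^x(f(X_T); delta < T < oo)]. *)
Lemma killed_semigroup_hit_value (delta : R) x : (0 < delta)%R ->
  killed_semigroup X P F delta (pathE (hit_value F f)) x =
  \int[P x]_w (hit_value F f (xi w) * indicator [set w | delta%:E < T (xi w)] w).
Proof.
move=> d0; rewrite /killed_semigroup.
rewrite (_ : [set w | _] = [set w | delta%:E < T (xi w)]); last first.
  by apply/seteqP; split => w /=; rewrite hitting_time_sample_path.
have hA := natural_filtration_unhit d0.
rewrite -integral_weight_indicator; last exact: natural_filtration_measurable hX _ _ hA.
rewrite -(markov_paths hE hX hcont x (ltW d0) hA (measurable_hit_value hE hF mf) hv0).
apply: eq_integral => w _; rewrite /indicator indicE.
case: (boolP (w \in _)) => [/set_mem/= dT|_]; last by rewrite !mule0.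
by rewrite hit_value_shift// ltW.
Qed.

(** Off [F] this says [Hf - p^0_delta Hf = E^x(f(X_T); T <= delta)].  The bound on
    [f] makes the subtraction legitimate. *)
Lemma hit_value_increment (N : nat) (delta : R) x : (forall x, f x <= N%:R%:E) ->
  (0 < delta)%R ->
  (pathE (hit_value F f) x - killed_semigroup X P F delta (pathE (hit_value F f)) x) *
    indicator (~` F : set (borel E)) x =
  pathE (early_hit_value F f delta) x.
Proof.
move=> fN d0; rewrite killed_semigroup_hit_value//.
set A := [set w | _].
have mA : measurable A := natural_filtration_measurable hX (natural_filtration_unhit d0).
have mhA (B : set Omega) : measurable B ->
    measurable_fun [set: Omega] (fun w => hit_value F f (xi w) * indicator B w).
  by move=> mB; apply: emeasurable_funM => //; exact: measurable_indicator.
have hA0 (B : set Omega) w : 0 <= hit_value F f (xi w) * indicator B w.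
  by apply: mule_ge0 => //; exact: indicator_ge0.
have -> : pathE (hit_value F f) x = \int[P x]_w (hit_value F f (xi w) * indicator A w) +
    \int[P x]_w (hit_value F f (xi w) * indicator (~` A) w).
  rewrite -ge0_integralD//; first last.
  - by apply: mhA; exact: measurableC.
  - exact: mhA.
  apply: eq_integral => w _; rewrite -ge0_muleDr; try exact: indicator_ge0.
  rewrite /indicator !indicE in_setC.
  by case: (w \in A); rewrite /= ?(adde0, add0e) mule1.
have fin : \int[P x]_w (hit_value F f (xi w) * indicator A w) \is a fin_num.
  rewrite ge0_fin_numE; last by apply: integral_ge0 => w _; exact: hA0.
  apply: (@le_lt_trans _ _ (\int[P x]_w (N%:R%:E))).
    apply: ge0_le_integral => //; first exact: mhA.
    move=> w _; rewrite /indicator indicE.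
    have hN : hit_value F f (xi w) <= N%:R%:E.
      by rewrite /hit_value; case: ifP => // _; rewrite lee_fin.
    by case: (w \in A); rewrite ?mule1// mule0 lee_fin.
  by rewrite integral_cst// (_ : P x _ = 1) ?mule1 ?ltry//; exact: prob_kernel.
rewrite addeAC subee// add0e.
rewrite -(integral_initial hE hX x (h := indicator (~` F : set (borel E)))).
- apply: eq_integral => w _; rewrite /early_hit_value -(coord_sample_path hcont w (lexx 0%R)).
  rewrite /indicator !indicE in_setC; case: asboolP => [[nF Td]|H].
    rewrite (mem_set (A := ~` F))// memNset; last by rewrite /A/= ltNge Td.
    by rewrite /= !mule1.
  have [/set_mem wA|wA] := boolP (w \in A); first by rewrite /= mule0 mul0e.
  rewrite memNset ?mule0//= => nF; apply: H; split => //.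
  by rewrite leNgt; apply: contra wA => dT; exact: mem_set.
- by apply: measurable_indicator; apply: measurableC; exact: borel_closed.
- exact: indicator_ge0.
- by apply: mhA; exact: measurableC.
- exact: hA0.
Qed.

Lemma energy_increment (N : nat) (delta : R) : (forall x, f x <= N%:R%:E) ->
  (0 < delta)%R ->
  \int[m]_(x in ~` F) ((pathE (hit_value F f) x -
     killed_semigroup X P F delta (pathE (hit_value F f)) x) * pathE Psi x) =
  \int[Pm]_w straddling_value F f Psi 0 delta (xi w).
Proof.
move=> fN d0.
have me := measurable_early_hit_value hE hF delta mf.
have e0 c : 0 <= early_hit_value F f delta c by rewrite /early_hit_value; case: ifP.
transitivity (\int[m]_x (pathE (early_hit_value F f delta \o stop_path delta) x * pathE Psi x)).
  rewrite integral_mkcond; apply: eq_integral => x _.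
  rewrite (_ : early_hit_value F f delta \o _ = early_hit_value F f delta); last first.
    by apply/funext => c /=; exact: early_hit_value_stop.
  rewrite -(hit_value_increment x fN d0) patchE /indicator indicE.
  by case: ifP => _; rewrite ?mule1// mule0 mul0e.
rewrite -(reversed_past_and_future hE hX hcont hsym (ltW d0) me e0 mPsi Psi0).
apply: eq_integral => w _; rewrite /straddling_value add0r; congr (early_hit_value _ _ _ _ * _).
by apply: path_eq; apply/funext => s; rewrite /= /coord/= add0r.
Qed.

Lemma straddling_value_ge0 a delta c : 0 <= straddling_value F f Psi a delta c.
Proof. by apply: mule_ge0 => //; rewrite /early_hit_value; case: ifP. Qed.

Lemma integral_straddling_value (a delta : R) : (0 <= a)%R -> (0 <= delta)%R ->
  \int[Pm]_w straddling_value F f Psi a delta (xi w) =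
  \int[Pm]_w straddling_value F f Psi 0 delta (xi w).
Proof.
move=> a0 d0.
have ms := measurable_straddling_value hE hF (lexx 0%R) d0 mf mPsi.
transitivity (\int[Pm]_w straddling_value F f Psi 0 delta (shift_path a (xi w))).
  apply: eq_integral => w _; rewrite /straddling_value !shift_shift addr0.
  by rewrite add0r.
rewrite (stationary_paths hE hX hcont hsym a0 ms (straddling_value_ge0 0 delta)).
rewrite integral_initial_m//; first exact: (measurable_on_sample_path hX hcont ms).
by move=> w; exact: straddling_value_ge0.
Qed.

Lemma integral_straddling_sum (t delta : R) : (0 < delta)%R ->
  \int[Pm]_w straddling_sum F f Psi t delta (xi w) =
  ((Num.truncn (t / delta)%R).-1%:R)%:E *
    \int[Pm]_w straddling_value F f Psi 0 delta (xi w).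
Proof.
move=> d0; rewrite /straddling_sum ge0_integral_sum//; last 2 first.
- move=> k; apply: (measurable_on_sample_path hX hcont).
  by apply: measurable_straddling_value => //; rewrite ?mulr_ge0// ltW.
- by move=> k w _; exact: straddling_value_ge0.
transitivity (\sum_(1 <= k < Num.truncn (t / delta)%R)
    \int[Pm]_w straddling_value F f Psi 0 delta (xi w)).
  apply: eq_bigr => k _; apply: integral_straddling_value; last exact: ltW.
  by rewrite mulr_ge0// ltW.
by rewrite sumr_const_nat subn1 mule_natl.
Qed.

End energy_identity.

(** * The expected excursion sum per unit of time *)

Section energy_limit.
Context (R : realType) (E : ptopologicalType).
Hypothesis hE : lusin_space R E.
Variable m : {sigma_finite_measure set (borel E) -> \bar R}.
Context (d : measure_display) (Omega : measurableType d)
  (X : R -> Omega -> E) (theta : R -> Omega -> Omega)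
  (P : R.-pker (borel E) ~> Omega).
Hypothesis hX : conservative_borel_right_process X theta P.
Hypothesis hcont : continuous_paths X.
Hypothesis hsym : symmetric_process X P m.
Variable F : set E.
Hypothesis hF : closed F.

Local Notation xi := (sample_path hcont).
Local Notation Pm := (initial_m P m).
Local Notation pathE := (path_expectation P hcont).

Variables (f : borel E -> \bar R) (Psi : paths R E -> \bar R).
Hypothesis mf : measurable_fun [set: borel E] f.
Hypothesis f0 : forall x, 0 <= f x.
Hypothesis mPsi : measurable_fun [set: paths R E] Psi.
Hypothesis Psi0 : forall c, 0 <= Psi c.
Hypothesis hPsi : unaffected_by_prehit_shift F Psi.

Lemma straddling_sum_ge0 t delta c : 0 <= straddling_sum F f Psi t delta c.
Proof. by apply: sume_ge0 => k _; exact: straddling_value_ge0. Qed.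

Lemma measurable_straddling_sum (t delta : R) : (0 < delta)%R ->
  measurable_fun [set: paths R E] (straddling_sum F f Psi t delta).
Proof.
move=> d0; apply: emeasurable_sum => k.
by apply: measurable_straddling_value => //; rewrite ?mulr_ge0// ltW.
Qed.

Lemma cvg_straddling_sum (t : R) (u : R^nat) c : (0 < t)%R ->
  (forall n, (0 < u n)%R) -> u n @[n --> \oo] --> (0 : R)%R ->
  straddling_sum F f Psi t (u n) c @[n --> \oo] --> excursion_sum F f Psi t c.
Proof.
move=> t0 u0 uc; apply: cvg_le_liminf.
  by move=> n; exact: straddling_sum_le.
exact: excursion_sum_le_liminf.
Qed.

Lemma excursion_sum_ge0 t c : 0 <= excursion_sum F f Psi t c.
Proof. by apply: esum_ge0 => s _; exact: excursion_value_ge0. Qed.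

Lemma measurable_excursion_sum (t : R) : (0 < t)%R ->
  measurable_fun [set: paths R E] (excursion_sum F f Psi t).
Proof.
move=> t0.
apply: (emeasurable_fun_cvg (fun n => straddling_sum F f Psi t (n.+1%:R^-1)%R)).
  by move=> n; apply: measurable_straddling_sum; rewrite invr_gt0.
move=> c _; apply: cvg_straddling_sum => //; exact: cvg_harmonic.
Qed.

Lemma cvg_integral_straddling_sum (t : R) (u : R^nat) : (0 < t)%R ->
  (forall n, (0 < u n)%R) -> u n @[n --> \oo] --> (0 : R)%R ->
  \int[Pm]_w straddling_sum F f Psi t (u n) (xi w) @[n --> \oo] -->
  \int[Pm]_w excursion_sum F f Psi t (xi w).
Proof.
move=> t0 u0 uc.
apply: cvg_integral_from_below => //.
- move=> n; exact: (measurable_on_sample_path hX hcont (measurable_straddling_sum t (u0 n))).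
- exact: (measurable_on_sample_path hX hcont (measurable_excursion_sum t0)).
- by move=> n w; exact: straddling_sum_ge0.
- by move=> n w; exact: straddling_sum_le.
- by move=> w; exact: cvg_straddling_sum.
Qed.

Lemma cvg_number_of_steps (t : R) (u : R^nat) : (0 < t)%R ->
  (forall n, (0 < u n)%R) -> u n @[n --> \oo] --> (0 : R)%R ->
  ((Num.truncn (t / u n)).-1%:R * u n)%R @[n --> \oo] --> t.
Proof.
move=> t0 u0 uc.
apply: (@squeeze_cvgr _ _ _ _ (fun n => t - 2 * u n)%R (cst t)).
- apply: nearW => n.
  have /truncn_itv/andP[k1 k2] : (0 <= t / u n)%R by rewrite divr_ge0// ltW.
  move: k1 k2; case: (Num.truncn _) => [|k]; rewrite ler_pdivlMr// ltr_pdivrMr//.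
    by rewrite !mul0r mul1r => k1 k2; have := u0 n; rewrite /cst/=; lra.
  by rewrite -!natr1 !mulrDl !mul1r => k1 k2; have := u0 n; rewrite /cst/=; lra.
- rewrite -[X in _ --> X](_ : (t - 2 * 0)%R = t); last by rewrite mulr0 subr0.
  by apply: cvgB; [exact: cvg_cst|apply: cvgM => //; exact: cvg_cst].
- exact: cvg_cst.
Qed.

(** The grid sum consists of [floor(t / delta) - 1] cells with the same expectation,
    its total expectation converges to that of the excursion sum, and
    [(floor(t / delta) - 1) delta] tends to [t]. *)
Lemma cvg_energy_increment (t : R) : (0 < t)%R ->
  (delta^-1)%:E * \int[Pm]_w straddling_value F f Psi 0 delta (xi w)
    @[delta --> 0%R^'+] -->
  (t^-1)%:E * \int[Pm]_w excursion_sum F f Psi t (xi w).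
Proof.
move=> t0; apply: cvg_at_right_seq => u u0 uc.
have Mc := cvg_number_of_steps t0 u0 uc.
pose M n := (Num.truncn (t / u n)).-1.
have tn0 : t != 0%R by rewrite gt_eqF.
have : ((M n)%:R * u n)^-1%:E * \int[Pm]_w straddling_sum F f Psi t (u n) (xi w)
    @[n --> \oo] --> (t^-1)%:E * \int[Pm]_w excursion_sum F f Psi t (xi w).
  apply: cvgeM.
  - by case: (integral _ _ _) => //=; rewrite ?invr_eq0.
  - by apply: cvg_EFin; [exact: nearW|exact: cvgV].
  - exact: cvg_integral_straddling_sum.
apply: cvg_trans; apply: near_eq_cvg; near=> n.
have Mu : (0 < (M n)%:R * u n)%R.
  near: n; have /cvgrPdist_lt/(_ t t0) hh := Mc.
  apply: (@filterS _ \oo _ _ _ _ hh) => n /=.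
  by rewrite ltr_distl => /andP[_]; rewrite ltrDr.
rewrite (integral_straddling_sum hE hX hcont hsym hF mf f0 mPsi Psi0)//.
rewrite muleA; congr (_ * _); rewrite -EFinM; congr EFin.
have M0 : (M n)%:R != 0%R :> R by move: Mu; rewrite pmulr_lgt0// => /gt_eqF ->.
by rewrite invfM mulrAC mulVf// mul1r.
Unshelve. all: by end_near. Qed.

Lemma energy_eq_excursion_rate (N : nat) (t : R) : (forall x, f x <= N%:R%:E) ->
  (0 < t)%R ->
  energy X P m F (pathE (hit_value F f)) (pathE Psi) =
  (t^-1)%:E * \int[Pm]_w excursion_sum F f Psi t (xi w).
Proof.
move=> fN t0; apply: cvg_lim => //.
apply: cvg_trans (cvg_energy_increment t0).
apply: near_eq_cvg; near=> delta.
by rewrite (energy_increment hE hX hcont hsym hF mf f0 mPsi Psi0 fN).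
Unshelve. all: by end_near. Qed.

End energy_limit.

(** * Truncation and the two formulas *)

Section truncation.
Context (R : realType) (E : ptopologicalType).
Implicit Types f : borel E -> \bar R.

Lemma truncate_le (n : nat) f x : truncate n f x <= n%:R%:E.
Proof. by rewrite /truncate ge_min lexx orbT. Qed.

Lemma truncate_ge0 (n : nat) f x : (forall x, 0 <= f x) -> 0 <= truncate n f x.
Proof. by move=> f0; rewrite /truncate le_min f0 lee_fin ler0n. Qed.

Lemma measurable_truncate (n : nat) f : measurable_fun [set: borel E] f ->
  measurable_fun [set: borel E] (truncate n f).
Proof. by move=> mf; exact: measurable_mine mf (measurable_cst _). Qed.

Lemma nondecreasing_truncate f x : nondecreasing_seq (fun n => truncate n f x).
Proof.
move=> n p np; rewrite /truncate le_min ge_min lexx/= ge_min.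
by rewrite lee_fin ler_nat np orbT.
Qed.

Lemma cvg_truncate f x : (forall x, 0 <= f x) -> truncate n f x @[n --> \oo] --> f x.
Proof.
move=> f0; have := f0 x; rewrite /truncate; case: (f x) => [r| |]// r0.
  apply: cvg_near_cst; exists (Num.truncn r).+1 => // n /= rn.
  by apply: min_l; rewrite lee_fin ltW// (lt_le_trans (truncnS_gt r))// ler_nat.
rewrite (_ : (fun n => _) = (fun n => n%:R%:E)); last first.
  by apply/funext => n; rewrite min_r ?leey.
by apply/cvgeryP; exact: cvgr_idn.
Qed.

End truncation.

Section excursion_rate.
Context (R : realType) (E : ptopologicalType).
Hypothesis hE : lusin_space R E.
Variable m : {sigma_finite_measure set (borel E) -> \bar R}.
Context (d : measure_display) (Omega : measurableType d)
  (X : R -> Omega -> E) (theta : R -> Omega -> Omega)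
  (P : R.-pker (borel E) ~> Omega).
Hypothesis hX : conservative_borel_right_process X theta P.
Hypothesis hcont : continuous_paths X.
Hypothesis hsym : symmetric_process X P m.
Variable F : set E.
Hypothesis hF : closed F.

Local Notation xi := (sample_path hcont).
Local Notation T c := (hitting_time (@coord R E) F c).
Local Notation Pm := (initial_m P m).
Local Notation pathE := (path_expectation P hcont).

Lemma hitting_operatorE (n : nat) (f : E -> \bar R) :
  hitting_operator X P F (truncate n f) = pathE (hit_value F (truncate n (f \_ F))).
Proof.
apply/funext => x; rewrite /hitting_operator integral_mkcond; apply: eq_integral => w _.
rewrite patchE /hit_value -(hitting_time_sample_path hcont).
have [Toy|Toy] := boolP (_ < +oo); last by rewrite memNset//; exact/negP.
rewrite mem_set//.
have Toy' : T (xi w) < +oo by rewrite -hitting_time_sample_path.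
have [r [rE r0 Fr]] := next_hit_fin hF Toy'.
rewrite hitting_time_sample_path [T (xi w)]rE [fine _]/=.
rewrite -(coord_sample_path hcont w r0) /truncate patchE mem_set//.
Qed.

Lemma never_hitE : never_hit X P F = pathE (avoids F).
Proof.
apply/funext => x; rewrite /never_hit /path_expectation.
have mA : measurable [set w | hitting_time X F w = +oo].
  have := measurable_on_sample_path hX hcont (measurable_hitting_time hE hF) measurableT
    (emeasurable_set1 +oo).
  rewrite setTI; congr measurable; apply/seteqP; split => w /=.
    by rewrite (hitting_time_sample_path hcont).
  by rewrite (hitting_time_sample_path hcont).
rewrite (eq_integral (indicator [set w | hitting_time X F w = +oo])); last first.
  move=> w _; rewrite /avoids /indicator indicE -(hitting_time_sample_path hcont).
  by case: eqP => h; [rewrite mem_set|rewrite memNset].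
by rewrite integral_indic// setIT.
Qed.

Lemma feller_measureE (f g : E -> \bar R) :
  feller_measure X P m F f g =
  limn (fun n => energy X P m F (pathE (hit_value F (truncate n (f \_ F))))
                               (pathE (hit_value F (truncate n (g \_ F))))).
Proof.
have e n : energy X P m F (hitting_operator X P F (truncate n f))
      (hitting_operator X P F (truncate n g)) =
    energy X P m F (pathE (hit_value F (truncate n (f \_ F))))
                   (pathE (hit_value F (truncate n (g \_ F)))).
  by rewrite !hitting_operatorE.
exact: (congr1 (fun u : (\bar R)^nat => limn u) (funext e)).
Qed.

Lemma supplementary_feller_measureE (f : E -> \bar R) :
  supplementary_feller_measure X P m F f =
  limn (fun n => energy X P m F (pathE (hit_value F (truncate n (f \_ F))))
                               (pathE (avoids F))).
Proof.
have e n : energy X P m F (hitting_operator X P F (truncate n f)) (never_hit X P F) =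
    energy X P m F (pathE (hit_value F (truncate n (f \_ F)))) (pathE (avoids F)).
  by rewrite hitting_operatorE never_hitE.
exact: (congr1 (fun u : (\bar R)^nat => limn u) (funext e)).
Qed.

Lemma expectation_excursion_sum (G : option E -> option E -> \bar R)
    (f : borel E -> \bar R) (Psi : paths R E -> \bar R) (t : R) : (0 < t)%R ->
  measurable_fun [set: borel E] f -> (forall x, 0 <= f x) ->
  measurable_fun [set: paths R E] Psi -> (forall c, 0 <= Psi c) ->
  unaffected_by_prehit_shift F Psi ->
  (forall w s, F (coord s (xi w)) -> s%:E < next_hit (@coord R E) F (xi w) s -> (0 < s)%R ->
    G (Some (X s w)) (extended_process X (next_hit (@coord R E) F (xi w) s) w) =
    excursion_value f Psi (xi w) s) ->
  expectation_m P m (fun w => excursion_measure X F G w `]0%R, t[%classic) =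
  \int[Pm]_w excursion_sum F f Psi t (xi w).
Proof.
move=> t0 mf f0 mPsi Psi0 hPsi hG; rewrite integral_initial_m.
- apply: eq_integral => x _; apply: eq_integral => w _.
  by apply: (excursion_measureE hF) => s; exact: hG.
- by apply: (measurable_on_sample_path hX hcont); exact: (measurable_excursion_sum hE).
- by move=> w; exact: excursion_sum_ge0.
Qed.

(** The formula holds at each level of truncation, and both the excursion sums and
    their expectations converge from below as the truncation is lifted. *)
Lemma excursion_rate (t : R) (f : borel E -> \bar R) (Psi : paths R E -> \bar R)
    (Psin : nat -> paths R E -> \bar R) : (0 < t)%R ->
  measurable_fun [set: borel E] f -> (forall x, 0 <= f x) ->
  measurable_fun [set: paths R E] Psi -> (forall c, 0 <= Psi c) ->
  unaffected_by_prehit_shift F Psi ->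
  (forall n, measurable_fun [set: paths R E] (Psin n)) -> (forall n c, 0 <= Psin n c) ->
  (forall n, unaffected_by_prehit_shift F (Psin n)) ->
  (forall c, nondecreasing_seq (Psin ^~ c)) ->
  (forall c, Psin n c @[n --> \oo] --> Psi c) ->
  \int[Pm]_w excursion_sum F f Psi t (xi w) =
  t%:E * limn (fun n => energy X P m F (pathE (hit_value F (truncate n f))) (pathE (Psin n))).
Proof.
move=> t0 mf f0 mPsi Psi0 hPsi mPsin Psin0 hPsin ndPsi cPsi.
have f0n n x : 0 <= truncate n f x by exact: truncate_ge0.
have below (u : (\bar R)^nat) l : nondecreasing_seq u -> u n @[n --> \oo] --> l ->
    forall n, u n <= l.
  move=> nd ul n; rewrite -(cvg_lim _ ul)// (cvg_lim _ (ereal_nondecreasing_cvgn nd))//.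
  by apply: ereal_sup_ubound; exists n.
have le_value n c s : excursion_value (truncate n f) (Psin n) c s <= excursion_value f Psi c s.
  apply: lee_pmul => //; last exact: (below _ _ (ndPsi _) (cPsi _)).
  by apply: (below (fun n => truncate n f _)); [exact: nondecreasing_truncate|exact: cvg_truncate].
have le_sum n c : excursion_sum F (truncate n f) (Psin n) t c <= excursion_sum F f Psi t c.
  by apply: le_esum => s _.
have -> : limn (fun n => energy X P m F (pathE (hit_value F (truncate n f))) (pathE (Psin n))) =
    (t^-1)%:E * \int[Pm]_w excursion_sum F f Psi t (xi w).
  rewrite (_ : (fun n => _) = (fun n => (t^-1)%:E *
      \int[Pm]_w excursion_sum F (truncate n f) (Psin n) t (xi w))); last first.
    apply/funext => n.
    apply: (energy_eq_excursion_rate hE hX hcont hsym hF _ _ _ _ _ (N := n)) => //.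
    - exact: measurable_truncate.
    - by move=> x; exact: truncate_le.
  apply: cvg_lim => //; apply: cvgeZl => //.
  apply: cvg_integral_from_below => //.
  - move=> n; apply: (measurable_on_sample_path hX hcont).
    by apply: (measurable_excursion_sum hE) => //; exact: measurable_truncate.
  - by apply: (measurable_on_sample_path hX hcont); exact: (measurable_excursion_sum hE).
  - by move=> n w; exact: excursion_sum_ge0.
  - move=> w; apply: cvg_esum_from_below => //.
      by move=> n s; exact: excursion_value_ge0.
    move=> s; apply: cvgeM_nondecreasing => //.
    + exact: nondecreasing_truncate.
    + exact: cvg_truncate.
by rewrite muleA -EFinM divff ?gt_eqF// mul1e.
Qed.

End excursion_rate.

Theorem theorem3p1 (R : realType) (E : ptopologicalType)
  (m : {sigma_finite_measure set (borel E) -> \bar R})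
  (d : measure_display) (Omega : measurableType d)
  (X : R -> Omega -> E) (theta : R -> Omega -> Omega)
  (P : R.-pker (borel E) ~> Omega)
  (F : set E) (f g : borel E -> \bar R)
  (hE : lusin_space R E)
  (hX : conservative_borel_right_process X theta P)
  (hcont : continuous_paths X)
  (hsym : symmetric_process X P m)
  (hF : closed F)
  (mf : measurable_fun (F : set (borel E)) f)
  (mg : measurable_fun (F : set (borel E)) g)
  (f0 : forall x, F x -> 0 <= f x)
  (g0 : forall x, F x -> 0 <= g x)
  (t : R) (t0 : (0 < t)%R) :
  expectation_m P m
      (fun w => excursion_measure X F (tensor f g) w `]0%R, t[%classic) =
    t%:E * feller_measure X P m F f g
  /\
  expectation_m P m
      (fun w => excursion_measure X F (tensor_Delta f) w `]0%R, t[%classic) =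
    t%:E * supplementary_feller_measure X P m F f.
Proof.
(* Only the values on [F] enter either side, so [f] and [g] are extended by 0. *)
have mext (h : borel E -> \bar R) : measurable_fun (F : set (borel E)) h ->
    measurable_fun [set: borel E] (h \_ F).
  by move=> mh; exact: (measurable_restrictT _ (borel_closed hF)).1 mh.
have ext0 (h : borel E -> \bar R) : (forall x, F x -> 0 <= h x) -> forall x, 0 <= (h \_ F) x.
  by move=> h0 x; rewrite patchE; case: ifPn => // /set_mem /h0.
have extE (h : borel E -> \bar R) x : F x -> (h \_ F) x = h x.
  by move=> Fx; rewrite patchE mem_set.
have shiftT (c : paths R E) s : hitting_time (@coord R E) F (shift_path s c) =
    next_hit (@coord R E) F c s - s%:E.
  by rewrite /hitting_time next_hit_shift addr0.
split.
- rewrite (expectation_excursion_sum (f := f \_ F) (Psi := hit_value F (g \_ F))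
    hE m hX (hcont := hcont) hF t0 (mext f mf) (ext0 f f0)); last 4 first.
  + exact: (measurable_hit_value hE hF (mext g mg)).
  + by move=> c; rewrite /hit_value; case: ifP => // _; exact: ext0.
  + exact: hit_value_shift.
  + move=> w s Fs sn s0; rewrite /tensor /excursion_value [extend_by_zero f _]/=; congr (_ * _).
      by rewrite extE// coord_sample_path// ltW.
    rewrite /hit_value shiftT.
    have := @next_hit_fin _ _ F hF (sample_path hcont w) s.
    move: sn; case: (next_hit _ _ _ s) => [r| |]// sr.
    move=> /(_ (ltry _))[_ [[<-] _ Fr]]; rewrite -EFinB ltry [fine _]/= [LHS]/=.
    rewrite coord_shift addrC subrK extE// coord_sample_path//.
    by apply: ltW; apply: lt_trans s0 _; rewrite -lte_fin.
  rewrite (feller_measureE m P hcont hF).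
  rewrite (excursion_rate (Psin := fun n => hit_value F (truncate n (g \_ F)))
    hE hX hcont hsym hF t0 (mext f mf) (ext0 f f0)).
  + by [].
  + exact: (measurable_hit_value hE hF (mext g mg)).
  + by move=> c; rewrite /hit_value; case: ifP => // _; exact: ext0.
  + exact: hit_value_shift.
  + by move=> n; apply: (measurable_hit_value hE hF); exact: measurable_truncate (mext g mg).
  + by move=> n c; rewrite /hit_value; case: ifP => // _; apply: truncate_ge0; exact: ext0.
  + by move=> n; exact: hit_value_shift.
  + move=> c n p np; rewrite /hit_value; case: ifP => // _.
    exact: nondecreasing_truncate.
  + move=> c; rewrite /hit_value; case: ifP => _; last exact: cvg_cst.
    by apply: cvg_truncate; exact: ext0.
- rewrite (expectation_excursion_sum (f := f \_ F) (Psi := avoids F)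
    hE m hX (hcont := hcont) hF t0 (mext f mf) (ext0 f f0)); last 4 first.
  + exact: (measurable_avoids hE hF).
  + by move=> c; rewrite /avoids; case: ifP.
  + exact: avoids_shift.
  + move=> w s Fs sn s0; rewrite /tensor_Delta /excursion_value [extend_by_zero f _]/=.
    congr (_ * _).
      by rewrite extE// coord_sample_path// ltW.
    rewrite /avoids shiftT.
    by move: sn; case: (next_hit _ _ _ s) => [r| |].
  rewrite (supplementary_feller_measureE hE m hX hcont hF).
  rewrite (excursion_rate (Psin := fun=> avoids F)
    hE hX hcont hsym hF t0 (mext f mf) (ext0 f f0)).
  + by [].
  + exact: (measurable_avoids hE hF).
  + by move=> c; rewrite /avoids; case: ifP.
  + exact: avoids_shift.
  + by move=> _; exact: (measurable_avoids hE hF).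
  + by move=> _ c; rewrite /avoids; case: ifP.
  + by move=> _; exact: avoids_shift.
  + by move=> c n p _.
  + by move=> c; exact: cvg_cst.
Qed.
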